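(* Assume the following conjecture (BC) holds. (BC): for every positive integer $m$ and every non-zero polynomial $h\in\mathbb{Q}[x_3,x_5,\ldots,x_{2m+1}]$ that is homogeneous with respect to the grading $\deg(x_{2k+1})=2k+1$, there exist infinitely many primes $p$ such that $p$ does not divide the numerator of $h(B_{p-3},B_{p-5},\ldots,B_{p-2m-1})$, where $B_i$ denotes the $i$-th Bernoulli number. Let $f\in\Lambda$ be a symmetric function over $\mathbb{Q}$ and let $n$ be a positive integer. Then the congruence $$f\left(\frac{p}{1},\frac{p}{2},\ldots,\frac{p}{p-1}\right)\equiv 0 \mod p^n$$ holds for all sufficiently large primes $p$ if and only if $\overline{f}\in I^{[n]}$, where $\overline{f}$ is the reduction of $f$ modulo $\mathcal{I}_n$, and $I^{[n]}\subset\Lambda/\mathcal{I}_n$ is the ideal generated by the elements $$\beta_k^{[n]}:=e_k+\sum_{j\geq k}(-1)^{j+1}\binom{j}{k}e_j\in\Lambda/\mathcal{I}_n,\qquad k\geq 0.$$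
   Context: $\Lambda=\Lambda_{\mathbb{Q}}$ is the ring of symmetric functions over $\mathbb{Q}$: formal power series of bounded degree in countably many variables with rational coefficients, invariant under all permutations of the variables. $e_k$ is the $k$-th elementary symmetric function ($e_0=1$); $\Lambda$ is the free commutative $\mathbb{Q}$-algebra on $e_1,e_2,\ldots$. A symmetric function is evaluated at a finite list of rationals by setting the remaining variables to $0$. The grading by $H$-degree on $\Lambda$ is the multiplicative grading in which $e_k$ (for $k\geq 1$) is homogeneous of $H$-degree $k+1$ (constants have $H$-degree $0$). For $f=\sum_m f_m$ with $f_m$ homogeneous of $H$-degree $m$, put $v(f):=\inf\{m: f_m\neq 0\}\in\mathbb{Z}_{\geq 0}\cup\{\infty\}$, and define the ideal $\mathcal{I}_n:=\{f\in\Lambda: v(f)\geq n\}$. The sum defining $\beta_k^{[n]}$ is finite since $e_j\in\mathcal{I}_n$ for all sufficiently large $j$. For $f\in\Lambda$ and all sufficiently large primes $p$ the value $f(p/1,\ldots,p/(p-1))$ lies in the localization $\mathbb{Z}_{(p)}$, and congruences modulo $p^n$ are understood in $\mathbb{Z}_{(p)}$. The numerator of a rational number refers to its expression in lowest terms. *)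

(* Defs.v *)
From HB Require Import structures.
From mathcomp Require Import all_boot all_order all_algebra.
From mathcomp Require Import fingroup perm generic_quotient ring_quotient.
From mathcomp Require Import finmap multiset mpoly.
From mathcomp Require Import boolp classical_sets functions cardinality fsbigop.

Set Implicit Arguments.
Unset Strict Implicit.
Unset Printing Implicit Defensive.

Import Order.TTheory GRing.Theory Num.Theory.

Local Open Scope ring_scope.
Local Open Scope mset_scope.
Local Open Scope classical_set_scope.

(* A monomial in x_0, x_1, ... is the finite multiset of its variable indices;
   variables are numbered from 0. *)
Local Notation mon := {mset nat}.

Lemma perm_msetD (a b : mon) : perm_eq (a `+` b)%mset (a ++ b).
Proof.
by apply/allP => i _ /=; rewrite count_cat !count_mem_mset msetE2.
Qed.

Lemma size_msetD (a b : mon) : size (a `+` b)%mset = (size a + size b)%N.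
Proof. by rewrite (perm_size (perm_msetD a b)) size_cat. Qed.

Lemma finite_msubset (m : mon) : finite_set [set d : mon | (d `<=` m)%mset].
Proof.
pose F (t : (size m).-tuple bool) : mon := seq_mset (mask t m).
apply: (@sub_finite_set _ _ [set F t | t in [set: (size m).-tuple bool]]).
  move=> d /= /msubsetP dm.
  have /count_subseqP[s /subseqP[t ts ->] ds] :
      forall x, (count_mem x d <= count_mem x m)%N.
    by move=> x; rewrite !count_mem_mset.
  have tS : size t == size m by apply/eqP.
  exists (Tuple tS) => //; rewrite /F /= -[RHS]seq_mset_id.
  by apply/eq_seq_msetP; rewrite perm_sym.
exact: finite_image.
Qed.

Definition msubsets (m : mon) : seq mon :=
  fset_set [set d : mon | (d `<=` m)%mset].

Lemma mem_msubsets (m d : mon) : (d \in msubsets m) = (d `<=` m)%mset.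
Proof.
rewrite in_fset_set; last exact: finite_msubset.
by apply/idP/idP; rewrite inE.
Qed.

Lemma msubsets_uniq m : uniq (msubsets m).
Proof. exact: fset_uniq. Qed.

(* Formal power series are functions monomial -> coefficient; the product below
   is convolution, not the pointwise product of functions. *)
Definition pseries : Type := mon -> rat.

HB.instance Definition _ := gen_eqMixin pseries.
HB.instance Definition _ := gen_choiceMixin pseries.
HB.instance Definition _ := GRing.Lmodule.copy pseries (mon -> rat^o).

Definition pseries1 : pseries := fun m => (m == mset0)%:R.

Definition pseries_mul (f g : pseries) : pseries := fun m =>
  \sum_(p \in [set p : mon * mon | (p.1 `+` p.2)%mset = m]) f p.1 * g p.2.

Lemma pmulE f g m :
  pseries_mul f g m = \sum_(a <- msubsets m) f a * g (m `\` a)%mset.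
Proof.
rewrite /pseries_mul (reindex_fsbig (fun a => (a, (m `\` a)%mset))
  [set d : mon | (d `<=` m)%mset]) /=; last first.
  split => [a /= am|a b _ _ [->] //|[a b] /= <-]; first exact: msetBDKC.
  by exists a; [apply/msubsetP => x; rewrite msetE2 leq_addr|rewrite msetDKB].
by rewrite fsbig_finite //; exact: finite_msubset.
Qed.

Lemma pmulES (S : seq mon) f g m : uniq S ->
    (forall a, (a `<=` m)%mset -> a \in S) ->
  pseries_mul f g m =
  \sum_(a <- S) \sum_(b <- S) (a `+` b == m)%mset%:R * (f a * g b).
Proof.
move=> uS mS; have sub a b : (a `+` b = m)%mset -> (a `<=` m)%mset.
  by move=> <-; apply/msubsetP => x; rewrite msetE2 leq_addr.
rewrite pmulE [RHS](bigID (fun a => (a `<=` m)%mset)) /=.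
rewrite [X in _ + X]big1 ?addr0; last first.
  move=> a /negP am; apply: big1 => b _.
  by case: eqP => [/sub//|_]; rewrite mul0r.
rewrite -[RHS]big_filter; apply: etrans (_ : \sum_(a <- [seq i <- S | i `<=` m]%mset) f a * g (m `\` a)%mset = _).
  apply: perm_big; apply: uniq_perm; rewrite ?filter_uniq ?msubsets_uniq //.
  by move=> a; rewrite mem_filter mem_msubsets; case: (boolP (a `<=` m)%mset) => // /mS.
apply: eq_big_seq => a; rewrite mem_filter => /andP[am _].
have bS : (m `\` a)%mset \in S by apply: mS; exact: msubsetDl.
rewrite (bigD1_seq _ bS uS) /= msetBDKC // eqxx mul1r big1 ?addr0 // => b nb.
case: eqP => [E|]; last by rewrite mul0r.
by rewrite -E msetDKB eqxx in nb.
Qed.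

Lemma pmulC : commutative pseries_mul.
Proof.
move=> f g; apply/funext => m.
rewrite !(@pmulES (msubsets m)) ?msubsets_uniq //;
  try by move=> a; rewrite mem_msubsets.
rewrite exchange_big /=; apply: eq_bigr => b _; apply: eq_bigr => a _.
by rewrite msetDC [f _ * _]mulrC.
Qed.

Lemma pmul3E f g h m : let S := msubsets m in
  pseries_mul f (pseries_mul g h) m =
  \sum_(a <- S) \sum_(b <- S) \sum_(c <- S)
    (a `+` (b `+` c) == m)%mset%:R * (f a * (g b * h c)).
Proof.
move=> S; have SP a : (a \in S) = (a `<=` m)%mset by exact: mem_msubsets.
have uS : uniq S by exact: msubsets_uniq.
rewrite (@pmulES S) //; last by move=> a; rewrite SP.
apply: eq_big_seq => a aS.
transitivity (\sum_(d <- S) \sum_(b <- S) \sum_(c <- S)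
    (a `+` d == m)%mset%:R * (b `+` c == d)%mset%:R * (f a * (g b * h c))).
  apply: eq_big_seq => d; rewrite SP => dm.
  rewrite (@pmulES S) //; last first.
    by move=> x xd; rewrite SP (msubset_trans xd dm).
  rewrite !mulr_sumr; apply: eq_bigr => b _; rewrite !mulr_sumr.
  by apply: eq_bigr => c _; rewrite -!mulrA; congr (_ * _); rewrite mulrCA.
rewrite exchange_big; apply: eq_bigr => b _.
rewrite exchange_big; apply: eq_bigr => c _.
rewrite -mulr_suml; congr (_ * _).
have [E|nE] := eqVneq (a `+` (b `+` c))%mset m; last first.
  apply: big1 => d _; have [<-|] := eqVneq (b `+` c)%mset d; rewrite ?mulr0 //.
  by rewrite (negbTE nE) mul0r.
have dS : (b `+` c)%mset \in S.
  by rewrite SP -E; apply/msubsetP => x; rewrite !msetE2 leq_addl.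
rewrite (bigD1_seq _ dS uS) /= E !eqxx mulr1 big1 ?addr0 // => d nd.
by rewrite [(_ `+` _)%mset == d]eq_sym (negbTE nd) mulr0.
Qed.

Lemma pmulA : associative pseries_mul.
Proof.
move=> f g h; rewrite [RHS]pmulC; apply/funext => m; rewrite !pmul3E.
rewrite [RHS]exchange_big /=; apply: eq_bigr => a _.
rewrite [RHS]exchange_big /=; apply: eq_bigr => b _.
apply: eq_bigr => c _; rewrite [(c `+` _)%mset]msetDC -msetDA; congr (_ * _).
by rewrite [RHS]mulrC mulrA.
Qed.

Lemma pmul1r : left_id pseries1 pseries_mul.
Proof.
move=> f; apply/funext => m; rewrite pmulE.
rewrite (bigD1_seq mset0) ?msubsets_uniq ?mem_msubsets ?msub0set //=.
rewrite /pseries1 eqxx mul1r msetB0 big1 ?addr0 // => a /negbTE->.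
by rewrite mul0r.
Qed.

Lemma pmulDl : left_distributive pseries_mul +%R.
Proof.
move=> f g h; apply/funext => m; rewrite [LHS]pmulE.
transitivity (pseries_mul f h m + pseries_mul g h m); last by [].
by rewrite !pmulE -big_split /=; apply: eq_bigr => a _; exact: mulrDl.
Qed.

Lemma pseries1_neq0 : pseries1 != 0 :> pseries.
Proof.
apply/eqP => /(congr1 (fun f : pseries => f mset0)) /eqP.
by rewrite /pseries1 eqxx oner_eq0.
Qed.

HB.instance Definition _ := GRing.Zmodule_isComNzRing.Build pseries
  pmulA pmulC pmul1r pmulDl pseries1_neq0.

Lemma pseries_scaleAl (c : rat) (f g : pseries) : c *: (f * g) = c *: f * g.
Proof.
apply/funext => m.
transitivity (c * pseries_mul f g m); first by [].
transitivity (pseries_mul (c *: f) g m); last by [].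
rewrite !pmulE mulr_sumr.
by apply: eq_bigr => a _; rewrite mulrA.
Qed.

HB.instance Definition _ :=
  GRing.Lmodule_isLalgebra.Build rat pseries pseries_scaleAl.
HB.instance Definition _ := GRing.Lalgebra_isComAlgebra.Build rat pseries.

Definition bounded_degree (f : pseries) : Prop :=
  exists d, forall m : mon, (d < size m)%N -> f m = 0.

(* The monomial obtained by substituting x_(s i) for x_i. *)
Definition relabel (s : nat -> nat) (m : mon) : mon :=
  seq_mset [seq s i | i <- m].

Definition perm_invariant (f : pseries) : Prop :=
  forall s, bijective s -> forall m : mon, f (relabel s m) = f m.

Definition symseries (f : pseries) : bool :=
  `[< bounded_degree f /\ perm_invariant f >].

Lemma relabelE s t m i : cancel s t -> cancel t s -> relabel s m i = m (t i).
Proof.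
move=> sK tK; rewrite mset_seqE count_map -count_mem_mset.
by apply: eq_count => j /=; rewrite -(can2_eq sK tK).
Qed.

Lemma relabelK s t : cancel s t -> cancel t s -> cancel (relabel s) (relabel t).
Proof.
move=> sK tK m; apply/msetP => i.
by rewrite (relabelE _ _ tK sK) (relabelE _ _ sK tK) sK.
Qed.

Lemma relabelD s a b : bijective s ->
  relabel s (a `+` b)%mset = (relabel s a `+` relabel s b)%mset.
Proof.
case=> t sK tK; apply/msetP => i.
by rewrite msetE2 !(relabelE _ _ sK tK) msetE2.
Qed.

Lemma size_relabel s m : size (relabel s m) = size m.
Proof. by rewrite (perm_size (perm_eq_seq_mset _)) size_map. Qed.

Lemma symseries_submod : submod_closed symseries.
Proof.
split=> [|c f g /asboolP[[df fd] fs] /asboolP[[dg gd] gs]]; apply/asboolP.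
  by split=> [|s _ m //]; exists 0%N.
split=> [|s bs m].
  exists (maxn df dg) => m; rewrite gtn_max => /andP[mf mg].
  transitivity (c * f m + g m) => //.
  by rewrite fd // gd // mulr0 addr0.
transitivity (c * f (relabel s m) + g (relabel s m)) => //.
by rewrite fs // gs.
Qed.

Lemma symseries_mulr : mulr_closed symseries.
Proof.
split=> [|f g /asboolP[[df fd] fs] /asboolP[[dg gd] gs]]; apply/asboolP.
  split=> [|s bs m].
    exists 0%N => m; rewrite lt0n size_mset_eq0 => m0.
    by transitivity (pseries1 m) => //; rewrite /pseries1 (negbTE m0).
  transitivity (pseries1 (relabel s m)) => //.
  transitivity (pseries1 m) => //.
  by rewrite /pseries1 -!size_mset_eq0 size_relabel.
split=> [|s bs m].
  exists (df + dg)%N => m dm; transitivity (pseries_mul f g m) => //.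
  apply: fsbig1 => -[/= a b] Em; move: dm; rewrite -Em size_msetD.
  have [/fd-> _|la] := ltnP df (size (a : mon)); first by rewrite mul0r.
  have [/gd->|lb] := ltnP dg (size (b : mon)); first by rewrite mulr0.
  by rewrite ltnNge leq_add.
transitivity (pseries_mul f g (relabel s m)) => //.
transitivity (pseries_mul f g m) => //; case: (bs) => t sK tK.
rewrite /pseries_mul (reindex_fsbig (fun p => (relabel s p.1, relabel s p.2))
  [set p : mon * mon | (p.1 `+` p.2)%mset = m]) /=.
  by apply: eq_fsbigr => -[a b] _ /=; rewrite fs // gs.
split=> [[a b] /= <-|[a b] [c d] _ _ [] /=|[a b] /= E].
- by rewrite relabelD.
- by move=> /(can_inj (relabelK sK tK))-> /(can_inj (relabelK sK tK))->.
- exists (relabel t a, relabel t b) => /=; last by rewrite !(relabelK tK sK).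
  rewrite -[m](relabelK sK tK) -E relabelD //.
  by exists s.
Qed.

HB.instance Definition _ :=
  GRing.isSubmodClosed.Build rat pseries symseries symseries_submod.
HB.instance Definition _ :=
  GRing.isMulClosed.Build pseries symseries symseries_mulr.

(* The ring Lambda of symmetric functions over the rationals. *)
Record symfun := SymFun { sfval :> pseries; _ : sfval \in symseries }.

HB.instance Definition _ := [isSub for sfval].
HB.instance Definition _ := [Choice of symfun by <:].
HB.instance Definition _ := [SubChoice_isSubComNzRing of symfun by <:].
HB.instance Definition _ := [SubZmodule_isSubLmodule of symfun by <:].
HB.instance Definition _ := [SubNzRing_SubLmodule_isSubLalgebra of symfun by <:].
HB.instance Definition _ := GRing.Lalgebra_isComAlgebra.Build rat symfun.

Lemma sfvalP (f : symfun) : bounded_degree f /\ perm_invariant f.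
Proof. by case: f => f /= /asboolP. Qed.

Lemma sfvalE (f g : symfun) : (forall m, sfval f m = sfval g m) -> f = g.
Proof. by move=> E; apply: val_inj; apply/funext. Qed.

(* e_k is the sum of all squarefree monomials of degree k. *)
Definition esym_series (k : nat) : pseries := fun m =>
  ((size m == k) && uniq m)%:R.

Lemma esym_subproof k : esym_series k \in symseries.
Proof.
apply/asboolP; split.
  by exists k => m /gtn_eqF mk; rewrite /esym_series mk.
move=> s /bij_inj si m; rewrite /esym_series size_relabel.
by rewrite (perm_uniq (perm_eq_seq_mset _)) map_inj_uniq.
Qed.

Definition esym (k : nat) : symfun := SymFun (esym_subproof k).

(* Evaluation at a finite list: the default 0 of a`_i sets the remaining
   variables to 0. The sum has finite support (sfeval_finite), so the big
   operator never falls back to its default value. *)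
Definition sfeval (f : symfun) (a : seq rat) : rat :=
  \sum_(m \in [set: mon]) sfval f m * \prod_(i <- (m : mon)) a`_i.

Section Restr.
Variable n : nat.
Implicit Types (k m : 'X_{1..n}).

Definition mon_of m : mon :=
  seq_mset (flatten [seq nseq (m i) (i : nat) | i <- enum 'I_n]).

Lemma mon_ofE m (i : 'I_n) : mon_of m i = m i.
Proof.
rewrite mset_seqE count_flatten -map_comp sumnE big_map big_enum /=.
rewrite (bigD1 i) //= count_nseq /= eqxx mul1n big1 ?addn0 // => j ji.
by rewrite count_nseq /= (inj_eq val_inj) (negbTE ji).
Qed.

Lemma mon_of0 m (i : nat) : (n <= i)%N -> mon_of m i = 0%N.
Proof.
move=> ni; rewrite mset_seqE count_flatten -map_comp sumnE big_map big_enum /=.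
apply: big1 => j _; rewrite count_nseq /=.
by rewrite ltn_eqF ?mul0n // (leq_trans _ ni).
Qed.

Lemma mon_ofP (a : mon) m : (forall i : 'I_n, a i = m i) ->
  (forall i, (n <= i)%N -> a i = 0%N) -> mon_of m = a.
Proof.
move=> am a0; apply/msetP => i; have [ni|ni] := leqP n i.
  by rewrite a0 // mon_of0.
by rewrite -[i]/(nat_of_ord (Ordinal ni)) mon_ofE am.
Qed.

Lemma mon_of_inj : injective mon_of.
Proof. by move=> k m E; apply/mnmP => i; rewrite -!mon_ofE E. Qed.

Lemma mon_of_surj (a : mon) : (forall i, (n <= i)%N -> a i = 0%N) ->
  mon_of [multinom a i | i < n] = a.
Proof. by move=> a0; apply: mon_ofP => // i; rewrite mnmE. Qed.

Lemma size_mon_of m : size (mon_of m) = mdeg m.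
Proof.
rewrite (perm_size (perm_eq_seq_mset _)) size_flatten sumnE big_map big_map.
by rewrite big_enum mdegE; apply: eq_bigr => i _; rewrite size_nseq.
Qed.

Lemma uniq_mon_of m : uniq (mon_of m) = [forall i, (m i <= 1)%N].
Proof.
apply/idP/forallP => [u i|u].
  by rewrite -mon_ofE -count_mem_mset count_uniq_mem ?leq_b1.
apply: count_mem_uniq => j; rewrite count_mem_mset in_mset.
have [nj|nj] := leqP n j; first by rewrite mon_of0.
rewrite -[j]/(nat_of_ord (Ordinal nj)) mon_ofE.
by case: (m _) (u (Ordinal nj)) => [|[]].
Qed.

Lemma mon_ofD k m : mon_of (k + m)%MM = (mon_of k `+` mon_of m)%mset.
Proof.
apply: mon_ofP => i; first by rewrite msetE2 !mon_ofE mnmE.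
by move=> ni; rewrite msetE2 !mon_of0.
Qed.

Lemma mon_ofB k m : mon_of (k - m)%MM = (mon_of k `\` mon_of m)%mset.
Proof.
apply: mon_ofP => i; first by rewrite msetE2 !mon_ofE mnmE.
by move=> ni; rewrite msetE2 !mon_of0.
Qed.

Definition sfdeg (f : symfun) : nat := projT1 (cid (sfvalP f).1).

Lemma sfdegP f (m : mon) : (sfdeg f < size m)%N -> sfval f m = 0.
Proof. by rewrite /sfdeg; case: cid => d /=; apply. Qed.

Definition restr (f : symfun) : {mpoly rat[n]} :=
  \sum_(m : 'X_{1..n < (sfdeg f).+1}) sfval f (mon_of m) *: 'X_[m].

Lemma mcoeff_restr f m : (restr f)@_m = sfval f (mon_of m).
Proof.
have [lt|ge] := ltnP (mdeg m) (sfdeg f).+1.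
  by rewrite (mcoeff_mpoly (fun m => sfval f (mon_of m))).
rewrite sfdegP ?size_mon_of // raddf_sum big1 //= => k _.
rewrite mcoeffZ mcoeffX; case: eqP => [E|]; last by rewrite mulr0.
by have := valP k; rewrite /= E ltnNge ge.
Qed.

Lemma restr_is_linear : linear restr.
Proof.
move=> c f g; apply/mpolyP => m.
by rewrite mcoeffD mcoeffZ !mcoeff_restr.
Qed.

Lemma restr_is_monoid : monoid_morphism restr.
Proof.
split=> [|f g]; apply/mpolyP => m.
  rewrite mcoeff_restr mcoeff1; transitivity (pseries1 (mon_of m)) => //.
  by rewrite /pseries1 -size_mset_eq0 size_mon_of mdeg_eq0.
rewrite mcoeff_restr; transitivity (pseries_mul (sfval f) (sfval g) (mon_of m)) => //.
have -> := mcoeff_poly_mul_lin (restr f) (restr g) (ltnSn (mdeg m)).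
rewrite pmulE -[RHS]big_filter (perm_big
  [seq mon_of (bmnm j) | j <- index_enum 'X_{1..n < (mdeg m).+1} & (bmnm j <= m)%MM]) /=.
  by rewrite big_map; apply: eq_bigr => k _; rewrite !mcoeff_restr mon_ofB.
apply: uniq_perm; rewrite ?msubsets_uniq //.
  rewrite map_inj_in_uniq ?filter_uniq ?index_enum_uniq //.
  by move=> a b _ _ /mon_of_inj /val_inj.
move=> a; rewrite mem_msubsets; apply/idP/idP => [am|/mapP[k]]; last first.
  rewrite mem_filter => /andP[/mnm_lepP km _ ->].
  apply/msubsetP => i; have [ni|ni] := leqP n i; first by rewrite !mon_of0.
  by rewrite -[i]/(nat_of_ord (Ordinal ni)) !mon_ofE.
have a0 i : (n <= i)%N -> a i = 0%N.
  move=> ni; apply/eqP; rewrite -leqn0; have /msubsetP/(_ i) := am.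
  by rewrite mon_of0.
pose k := [multinom a i | i < n]; have km : (k <= m)%MM.
  apply/mnm_lepP => i; rewrite mnmE -mon_ofE.
  by have /msubsetP := am; apply.
have kd : (mdeg k < (mdeg m).+1)%N.
  by rewrite ltnS -(submK km) mdegD leq_addl.
apply/mapP; exists (BMultinom kd); last by rewrite /= mon_of_surj.
by rewrite mem_filter mem_index_enum andbT.
Qed.

HB.instance Definition _ :=
  GRing.isLinear.Build rat symfun {mpoly rat[n]} *:%R restr restr_is_linear.
HB.instance Definition _ :=
  GRing.isMonoidMorphism.Build symfun {mpoly rat[n]} restr restr_is_monoid.

Lemma restr_esym r : restr (esym r) = mesym n rat r.
Proof.
apply/mpolyP => m; rewrite mcoeff_restr mcoeff_mesym.
by rewrite /= /esym_series size_mon_of uniq_mon_of.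
Qed.

Lemma restr_sym f : restr f \is symmetric.
Proof.
apply/issymP => s; apply/mpolyP => m; rewrite mcoeff_sym !mcoeff_restr.
pose ext (s : 'S_n) (i : nat) := oapp (fun j : 'I_n => s j : nat) i (insub i).
have extK (u v : 'S_n) : cancel u v -> cancel (ext u) (ext v).
  move=> uK i; rewrite /ext; case: (insubP _ i) => [j _ <-|/negbTE ni] /=.
    by rewrite valK /= uK.
  by rewrite insubF.
have bs : bijective (ext s^-1%g).
  by exists (ext s); apply: extK; [exact: permKV|exact: permK].
have [_ /(_ _ bs (mon_of m)) <-] := sfvalP f.
congr (sfval f _); apply: mon_ofP => i.
  rewrite (relabelE _ _ (extK _ _ (permKV s)) (extK _ _ (permK s))) /ext.
  by rewrite valK /= mon_ofE mnmE.
move=> ni; rewrite (relabelE _ _ (extK _ _ (permKV s)) (extK _ _ (permK s))).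
by rewrite /ext insubF /= ?mon_of0 // ltnNge ni.
Qed.

End Restr.

Lemma move_to_front (u : seq nat) : uniq u ->
  exists2 s : nat -> nat, bijective s &
    forall i, (i < size u)%N -> s (nth 0%N u i) = i.
Proof.
elim/last_ind: u => [|u x IH]; first by exists id => //; exists id.
rewrite rcons_uniq => /andP[xu uu]; have [s bs sE] := IH uu.
pose a := size u; pose b := s x.
pose t j := if j == a then b else if j == b then a else j.
have tK : involutive t.
  move=> j; rewrite /t; have [->|ja] := eqVneq j a.
    by rewrite eqxx; case: eqVneq => [->|].
  have [->|jb] := eqVneq j b; first by rewrite eqxx.
  by rewrite (negbTE ja) (negbTE jb).
exists (t \o s); first by apply: bij_comp => //; exists t.
move=> i; rewrite size_rcons ltnS nth_rcons leq_eqVlt => /orP[/eqP->|iu] /=.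
  rewrite ltnn eqxx /t -/b; case: (eqVneq b a) => //.
  by rewrite eqxx.
rewrite iu sE // /t ltn_eqF //; case: eqP => // ib.
by move: xu; rewrite -(bij_inj bs (etrans (sE i iu) ib)) mem_nth.
Qed.

Definition degree_le (d : nat) (f : symfun) : Prop :=
  forall m : mon, (d < size m)%N -> sfval f m = 0.

Lemma restr_eq0 n (f : symfun) : degree_le n f -> restr n f = 0 -> f = 0.
Proof.
move=> fd f0; apply: sfvalE => a; have [/fd->//|an] := ltnP n (size a).
have [s bs sE] := move_to_front (undup_uniq (a : seq nat)).
have [_ /(_ s bs a) <-] := sfvalP f.
rewrite -(@mon_of_surj n (relabel s a)).
  by rewrite -mcoeff_restr f0 mcoeff0.
move=> i ni; apply/eqP; rewrite mset_eq0 -has_pred1 (eq_has_r (perm_mem (perm_eq_seq_mset _))).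
rewrite has_pred1; apply/negP => /mapP[x]; rewrite -mem_undup => xa iE.
have := nth_index 0%N xa; have := xa; rewrite -index_mem => lt xE.
move: iE; rewrite -xE sE // => iE; move: lt; rewrite -iE ltnNge => /negP; apply.
exact: leq_trans (size_undup _) (leq_trans an ni).
Qed.

Lemma degree_leW d e f : (d <= e)%N -> degree_le d f -> degree_le e f.
Proof. by move=> de fd m em; apply: fd; exact: leq_ltn_trans em. Qed.

Lemma degree_leD d f g :
  degree_le d f -> degree_le d g -> degree_le d (f + g).
Proof.
move=> fd gd m dm; transitivity (sfval f m + sfval g m) => //.
by rewrite fd // gd // addr0.
Qed.

Lemma degree_leZ d c f : degree_le d f -> degree_le d (c *: f).
Proof.
move=> fd m dm; transitivity (c * sfval f m) => //.
by rewrite fd // mulr0.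
Qed.

Lemma degree_leM d e f g :
  degree_le d f -> degree_le e g -> degree_le (d + e) (f * g).
Proof.
move=> fd gd m dm.
transitivity (pseries_mul (sfval f) (sfval g) m) => //.
apply: fsbig1 => -[/= a b] Em; move: dm; rewrite -Em size_msetD.
have [/fd-> _|la] := ltnP d (size (a : mon)); first by rewrite mul0r.
have [/gd->|lb] := ltnP e (size (b : mon)); first by rewrite mulr0.
by rewrite ltnNge leq_add.
Qed.

Lemma degree_le1 : degree_le 0 1.
Proof.
move=> m; rewrite lt0n size_mset_eq0 => m0.
by transitivity (pseries1 m) => //; rewrite /pseries1 (negbTE m0).
Qed.

Lemma degree_le_esym k : degree_le k (esym k).
Proof. by move=> m /gtn_eqF mk; rewrite /= /esym_series mk. Qed.

Definition emonomial (s : seq nat) : symfun := \prod_(k <- s) esym k.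

(* H-degree of e_(k_1) ... e_(k_r) for positive k_i. Since e_0 = 1 has H-degree
   0, sequences containing 0 are excluded wherever Hdegree is used. *)
Definition Hdegree (s : seq nat) : nat := \sum_(k <- s) k.+1.

Lemma degree_le_emonomial s : degree_le (sumn s) (emonomial s).
Proof.
rewrite /emonomial; elim: s => [|k s IH]; first by rewrite big_nil; exact: degree_le1.
by rewrite big_cons /=; apply: degree_leM => //; exact: degree_le_esym.
Qed.

Definition ecomb (l : seq (rat * seq nat)) : symfun :=
  \sum_(x <- l) x.1 *: emonomial x.2.

(* The e_k (k >= 1) generate Lambda: the part of the fundamental theorem that is
   needed to see that Hideal is an ideal. *)
Theorem esym_generate (f : symfun) :
  exists2 l, all (fun x => all (leq 1) x.2) l & f = ecomb l.
Proof.
have [[d fd] _] := sfvalP f.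
have [t [tE tw]] := sym_fundamental (restr_sym d f).
pose s (m : 'X_{1..d}) := flatten [seq nseq (m i) (i : nat).+1 | i <- enum 'I_d].
pose l := [seq (t@_m, s m) | m <- msupp t].
have lpos : all (fun x : rat * seq nat => all (leq 1) x.2) l.
  apply/allP => _ /mapP[m _ ->] /=; apply/allP => k /flattenP[_ /mapP[i _ ->]].
  by move=> /nseqP[->].
exists l => //; apply/eqP; rewrite -subr_eq0; apply/eqP; apply: (@restr_eq0 d).
  apply: degree_leD => //; rewrite -scaleN1r; apply: degree_leZ.
  rewrite /ecomb big_map big_seq.
  apply: (big_ind (degree_le d)) => //; first exact: degree_leD.
  move=> m mt; apply: degree_leZ; apply: (@degree_leW (sumn (s m))); last exact: degree_le_emonomial.
  have -> : sumn (s m) = mnmwgt m.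
    rewrite /s sumn_flatten -map_comp sumnE big_map big_enum /mnmwgt /=.
    by apply: eq_bigr => i _; rewrite /= sumn_nseq mulnC.
  have := leq_trans (mmeasure_mnm_lt _ mt) tw; rewrite /=.
  move=> /leq_trans-/(_ d.+1); rewrite ltnS; apply.
  rewrite mmeasureE; apply/bigmax_leqP_seq => k; rewrite mcoeff_msupp => kt _.
  rewrite ltnS leqNgt; apply: contra kt => lt.
  by rewrite mcoeff_restr fd // size_mon_of.
suff E : restr d (ecomb l) = restr d f by rewrite raddfB /= E subrr.
rewrite -tE comp_mpolyEX /ecomb raddf_sum big_map /=.
apply: eq_bigr => m _.
rewrite linearZ /=; congr (_ *: _).
rewrite comp_mpolyX /emonomial big_flatten big_map big_enum rmorph_prod /=.
apply: eq_bigr => i _; rewrite tnth_mktuple big_nseq.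
by rewrite -Monoid.iteropE rmorphXn /= restr_esym.
Qed.

Lemma sfeval_finite (f : symfun) (a : seq rat) :
  finite_set [set m : mon | sfval f m * \prod_(i <- (m : mon)) a`_i != 0].
Proof.
pose n := size a; pose F (k : 'X_{1..n < (sfdeg f).+1}) : mon := mon_of (bmnm k).
apply: (@sub_finite_set _ _ [set F k | k in [set: 'X_{1..n < (sfdeg f).+1}]]);
  last exact: finite_image.
move=> m /= nz.
have m0 i : (n <= i)%N -> m i = 0%N.
  move=> ni; apply/eqP; rewrite mset_eq0; apply: contra nz => im.
  have ai : a`_i = 0 by exact: nth_default.
  by rewrite (perm_big _ (perm_to_rem im)) big_cons /= ai mul0r mulr0.
have md : (mdeg [multinom m i | i < n] < (sfdeg f).+1)%N.
  rewrite ltnNge -size_mon_of mon_of_surj //; apply: contra nz => md.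
  by rewrite sfdegP // mul0r.
by exists (BMultinom md) => //; rewrite /F /= mon_of_surj.
Qed.

Lemma ecomb_cat l1 l2 : ecomb (l1 ++ l2) = ecomb l1 + ecomb l2.
Proof. exact: big_cat. Qed.

Definition Hhomogeneous (m : nat) (f : symfun) : Prop :=
  exists2 l, all (fun x => all (leq 1) x.2 && (Hdegree x.2 == m)) l &
    f = ecomb l.

Definition Hdecomposition (f : symfun) (g : nat -> symfun) : Prop :=
  (forall m, Hhomogeneous m (g m)) /\
  exists2 N, (forall m, (N <= m)%N -> g m = 0) & f = \sum_(m < N) g m.

(* v(f) >= n, i.e. all nonzero components f_m of f have m >= n. As the e_k are
   free generators, the decomposition of f is unique, and the existential
   quantifier speaks about the decomposition. *)
Definition Hideal (n : nat) (f : symfun) : bool :=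
  `[< exists2 g, Hdecomposition f g & forall m, g m != 0 -> (n <= m)%N >].

Lemma HidealP n f : reflect
  (exists2 l, all (fun x => all (leq 1) x.2 && (n <= Hdegree x.2)%N) l &
    f = ecomb l) (f \in Hideal n).
Proof.
apply: (iffP (asboolP _)) => [[g [gh [N _ ->]] gn]|[l lP ->]].
  apply: (big_ind (fun f => exists2 l, all (fun x => all (leq 1) x.2 &&
      (n <= Hdegree x.2)%N) l & f = ecomb l)).
  - by exists [::]; rewrite // /ecomb big_nil.
  - move=> _ _ [l1 P1 ->] [l2 P2 ->]; exists (l1 ++ l2); last by rewrite ecomb_cat.
    by rewrite all_cat P1.
  move=> m _; have [->|/gn nm] := eqVneq (g m) 0.
    by exists [::]; rewrite // /ecomb big_nil.
  have [l lP ->] := gh m; exists l => //.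
  apply: sub_all lP => x /andP[-> /eqP->] /=; exact: nm.
pose N := (\max_(x <- l) Hdegree x.2).+1.
have lN x : x \in l -> (Hdegree x.2 < N)%N.
  by move=> xl; rewrite ltnS (big_rem x) //= leq_maxl.
exists (fun m => ecomb [seq x <- l | Hdegree x.2 == m]).
  split=> [m|].
    exists [seq x <- l | Hdegree x.2 == m] => //.
    rewrite all_filter; apply: sub_all lP => x /andP[px _] /=.
    by apply/implyP => ->; rewrite px.
  exists N => [m Nm|].
    rewrite (eq_in_filter (a2 := pred0)) ?filter_pred0 /ecomb ?big_nil //.
    by move=> x /lN xN /=; rewrite ltn_eqF // (leq_trans xN).
  rewrite /ecomb (eq_bigr (fun m : 'I_N =>
      \sum_(x <- l | Hdegree x.2 == m) x.1 *: emonomial x.2)); last first.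
    by move=> m _; rewrite big_filter.
  rewrite (exchange_big_dep xpredT) //= big_seq [RHS]big_seq.
  apply: eq_bigr => x /lN xN; rewrite (big_pred1 (Ordinal xN)) //.
move=> m; apply: contra_neqT; rewrite -ltnNge => mn.
rewrite (eq_in_filter (a2 := pred0)) ?filter_pred0 /ecomb ?big_nil //.
move=> x xl /=; have /andP[_ nx] := allP lP x xl.
by rewrite gtn_eqF // (leq_trans mn).
Qed.

Lemma emonomial_cat s t : emonomial (s ++ t) = emonomial s * emonomial t.
Proof. exact: big_cat. Qed.

Lemma ecombM l1 l2 : ecomb l1 * ecomb l2 =
  ecomb [seq (x.1 * y.1, x.2 ++ y.2) | x <- l1, y <- l2].
Proof.
rewrite /ecomb big_allpairs_dep mulr_suml; apply: eq_bigr => x _.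
rewrite mulr_sumr; apply: eq_bigr => y _ /=.
by rewrite emonomial_cat -scalerAl -scalerAr scalerA.
Qed.

Lemma Hideal_proper n : idealr_closed (Hideal n.+1).
Proof.
split.
- by apply/HidealP; exists [::] => //; rewrite /ecomb big_nil.
- apply/negP => /HidealP[l lP] /(congr1 (fun f => sfval f mset0)) /eqP.
  suff -> : sfval (ecomb l) mset0 = 0.
    rewrite -[sfval 1 mset0]/(pseries1 mset0) /pseries1 eqxx.
    by rewrite (negbTE (oner_neq0 _)).
  rewrite /ecomb big_seq.
  apply: (big_ind (fun f : symfun => sfval f mset0 = 0)) => //.
    move=> f g f0 g0; transitivity (sfval f mset0 + sfval g mset0) => //.
    by rewrite f0 g0 addr0.
  move=> x xl; have /andP[] := allP lP x xl.
  case: x.2 => [|k s]; first by rewrite /Hdegree big_nil.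
  move=> /= /andP[k0 _] _.
  transitivity (x.1 * sfval (emonomial (k :: s)) mset0) => //.
  rewrite /emonomial big_cons -/(emonomial s).
  have -> : sfval (esym k * emonomial s) mset0 = 0; last by rewrite mulr0.
  transitivity (pseries_mul (sfval (esym k)) (sfval (emonomial s)) mset0) => //.
  rewrite pmulE big_seq big1 // => a; rewrite mem_msubsets msubset0 => /eqP->.
  by rewrite /= /esym_series size_mset0 eq_sym eqn0Ngt k0 mul0r.
move=> f g h /HidealP[l1 P1 ->] /HidealP[l2 P2 ->].
have [l lP ->] := esym_generate f.
rewrite ecombM -ecomb_cat; apply/HidealP; eexists; last by [].
rewrite all_cat P2 andbT; apply/allP => _ /allpairsP[[x y] [/= xl yl ->]] /=.
have xP := allP lP x xl; have /andP[yP yn] := allP P1 y yl.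
by rewrite all_cat xP yP /Hdegree big_cat /= (leq_trans yn) // leq_addl.
Qed.

HB.instance Definition _ n :=
  isIdealr.Build symfun (Hideal n.+1) (Hideal_proper n).

(* A {ideal_quot _} needs a proper ideal, whence n.-1.+1, which is n for n > 0;
   the value n = 0 is meaningless, as for 'Z_n. *)
Definition idealH (n : nat) : idealr symfun := Hideal n.-1.+1.

Definition symquot (n : nat) : comNzRingType := {ideal_quot idealH n}.

Definition symbar (n : nat) (f : symfun) : symquot n :=
  \pi_({ideal_quot idealH n})%qT f.

Lemma esym_Hideal n j : (n <= j.+1)%N -> (0 < j)%N -> esym j \in Hideal n.
Proof.
move=> nj j0; apply/HidealP; exists [:: (1, [:: j])].
  by rewrite /= j0 /Hdegree big_seq1 nj.
by rewrite /ecomb big_seq1 scale1r /emonomial big_seq1.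
Qed.

Lemma symbar_eq0 n f : (symbar n f == 0) = (f \in Hideal n.-1.+1).
Proof.
rewrite /symbar -[f in RHS]subr0 Quotient.idealrBE.
by rewrite -[0 in LHS](rmorph0 (\pi_({ideal_quot idealH n})%qT)).
Qed.

(* In the quotient by v(f) >= n almost all terms of the sum vanish
   (beta_finite). *)
Definition beta (n k : nat) : symquot n :=
  symbar n (esym k) +
  \sum_(j \in [set j | (k <= j)%N])
    (-1) ^+ j.+1 * 'C(j, k)%:R * symbar n (esym j).

Lemma beta_finite n k : finite_set [set j |
  (k <= j)%N /\ (-1) ^+ j.+1 * 'C(j, k)%:R * symbar n (esym j) != 0].
Proof.
apply: (@sub_finite_set _ _ `I_n.+1); last exact: finite_II.
move=> j /= [_]; apply: contra_neqT; rewrite -leqNgt => nj.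
have j0 : (0 < j)%N by exact: leq_trans nj.
suff /eqP-> : symbar n (esym j) == 0 by rewrite mulr0.
rewrite symbar_eq0; apply: esym_Hideal => //.
by case: n nj => [|n] //= /ltnW /leqW.
Qed.

Definition gen_ideal (R : comNzRingType) (B : set R) : set R :=
  [set x | exists2 l : seq (R * R), {in l, forall y, B y.2} &
    x = \sum_(y <- l) y.1 * y.2].

(* The localization of the integers at the prime p, inside the rationals. *)
Definition Zlocal (p : nat) : {pred rat} := [pred x | ~~ (p %| `|denq x|)%N].

Definition eqmod_local (p n : nat) (x y : rat) : Prop :=
  exists2 z, z \in Zlocal p & x - y = p%:R ^+ n * z.

Definition harmonic_point (p : nat) : seq rat :=
  [seq p%:R / i%:R | i <- iota 1 p.-1].

(* The sequence B_0, ..., B_n, with B_1 = -1/2; see bernoulli0 and bernoulli_rec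
   for the characteristic recursion. *)
Fixpoint bernoulli_upto (n : nat) : seq rat :=
  if n is n'.+1 then
    let s := bernoulli_upto n' in
    rcons s (- n.+1%:R^-1 * \sum_(k < n) 'C(n.+1, k)%:R * s`_k)
  else [:: 1].

Definition bernoulli (n : nat) : rat := (bernoulli_upto n)`_n.

Lemma size_bernoulli_upto n : size (bernoulli_upto n) = n.+1.
Proof. by elim: n => //= n IH; rewrite size_rcons IH. Qed.

Lemma nth_bernoulli_upto n k : (k <= n)%N -> (bernoulli_upto n)`_k = bernoulli k.
Proof.
elim: n => [|n IH]; first by rewrite leqn0 => /eqP->.
rewrite leq_eqVlt => /orP[/eqP->//|kn].
by rewrite /= nth_rcons size_bernoulli_upto kn IH.
Qed.

Lemma bernoulli0 : bernoulli 0 = 1. Proof. by []. Qed.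

Lemma bernoulli_rec n : (0 < n)%N ->
  \sum_(k < n.+1) 'C(n.+1, k)%:R * bernoulli k = 0.
Proof.
case: n => // n _; rewrite big_ord_recr /= {2}/bernoulli /= nth_rcons.
rewrite size_bernoulli_upto ltnn eqxx binSn mulNr mulrN mulVKf ?pnatr_eq0 //.
apply/eqP; rewrite subr_eq0; apply/eqP; apply: eq_bigr => k _.
by rewrite nth_bernoulli_upto // -ltnS.
Qed.

(* The variable of index i < m stands for x_(2i+3), so that the m variables are
   x_3, x_5, ..., x_(2m+1). *)
Definition whomogeneous (m : nat) (h : {mpoly rat[m]}) : Prop :=
  exists d, {in msupp h, forall mu : 'X_{1..m}, (\sum_(i < m) mu i * (2 * i + 3) = d)%N}.

(* The condition 2m+1 <= p only makes the subtractions p - (2i+3) exact; it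
   excludes finitely many primes. *)
Definition BC : Prop :=
  forall (m : nat) (h : {mpoly rat[m]}),
    (0 < m)%N -> h != 0 -> whomogeneous h ->
  forall N : nat, exists p : nat,
    [/\ prime p, (N <= p)%N, (2 * m + 1 <= p)%N &
        ~~ (p %| `|numq h.@[fun i => bernoulli (p - (2 * i + 3))]|)%N].

(* Main.v *)
Require Import Defs.
From HB Require Import structures.
From mathcomp Require Import all_boot all_order all_algebra.
From mathcomp Require Import fingroup perm generic_quotient ring_quotient.
From mathcomp Require Import finmap multiset mpoly.
From mathcomp Require Import boolp classical_sets functions cardinality fsbigop.
From mathcomp Require Import zify ring.

Set Implicit Arguments.
Unset Strict Implicit.
Unset Printing Implicit Defensive.

Import Order.TTheory GRing.Theory Num.Theory.

Local Open Scope ring_scope.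
Local Open Scope classical_set_scope.

Local Notation e_ := Defs.esym.

(* The value of e_r at the harmonic point is p^r c_r / (p-1)!, where c_r is the
   coefficient of X^r in G = (X+1)...(X+p-1). Lagrange's identity
   (X+1) G(X+1) = (X+p) G(X) is, modulo p^2, the recursion of the Bernoulli
   numbers. So, for 0 < r < p-1, the value of e_r is divisible by p^(r+1), where
   r+1 is the H-degree of e_r, and for even r (p odd) it is congruent to
   -p^(r+1) B_(p-1-r) / (r+1) modulo p^(r+2).
   The product of the 1 + pX/i over 0 < i < p is invariant under X -> -1-X
   (exchange i and p-i); comparing coefficients shows that the beta_k vanish at
   the harmonic point. Conversely, modulo the beta_k an e_k of odd index is a
   combination of e_j with j > k, so every f reduces to a polynomial in the e_j
   of even index; if a monomial of H-degree less than n survived, the component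
   of least H-degree would give a form in Bernoulli numbers contradicting BC. *)

(** * Divisibility by powers of p in the localization at p *)

(** Allows fractions that are not in lowest terms, which makes the closure properties easy. By
    Gauss's lemma the reduced denominator divides every other one. *)
Lemma ZlocalP p (x : rat) : prime p ->
  reflect (exists a : int, exists2 b : nat, ~~ (p %| b)%N & x * b%:R = a%:~R)
    (x \in Zlocal p).
Proof.
move=> pp; rewrite /Zlocal inE /=; apply: (iffP idP).
  move=> px; exists (numq x), `|denq x|%N => //.
  by rewrite numqE -absz_denq.
case=> a [b pb E]; apply: contra pb => /dvdn_trans; apply.
have {}E : numq x * b%:Z = a * denq x.
  apply: (intr_inj (R := rat)); rewrite !rmorphM /= numqE -E.
  by rewrite mulrAC.
have : (denq x %| numq x * b%:Z)%Z by rewrite E dvdz_mull.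
by rewrite Gauss_dvdzr // coprimezE coprime_sym coprime_num_den.
Qed.

Section Local.
Variables (p : nat) (p_pr : prime p).

Lemma Zlocal_int (a : int) : a%:~R \in Zlocal p.
Proof.
apply/ZlocalP => //; exists a, 1%N; last by rewrite mulr1.
by rewrite dvdn1 neq_ltn prime_gt1 ?orbT.
Qed.

Lemma Zlocal_subring : subring_closed (Zlocal p).
Proof.
split; first exact: (Zlocal_int 1).
- move=> x y /(ZlocalP _ p_pr)[a [b pb E]] /(ZlocalP _ p_pr)[c [d pd F]].
  apply/ZlocalP => //; exists (a * d%:Z - c * b%:Z), (b * d)%N.
    by rewrite Euclid_dvdM // negb_or pb.
  by rewrite rmorphB !rmorphM /= -E -F -!pmulrn; ring.
- move=> x y /(ZlocalP _ p_pr)[a [b pb E]] /(ZlocalP _ p_pr)[c [d pd F]].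
  apply/ZlocalP => //; exists (a * c), (b * d)%N.
    by rewrite Euclid_dvdM // negb_or pb.
  by rewrite !rmorphM /= -E -F; ring.
Qed.

Lemma Zlocal_invn n : ~~ (p %| n)%N -> n%:R^-1 \in Zlocal p.
Proof.
move=> pn; apply/ZlocalP => //; exists 1, n => //.
by rewrite mulVf // pnatr_eq0; apply: contra pn => /eqP->.
Qed.

Lemma p_neq0 : p%:R != 0 :> rat.
Proof. by rewrite pnatr_eq0 -lt0n prime_gt0. Qed.

(* p^n Z_(p); the unused proof of primality is an argument so that the closure
   under subtraction, which fails for composite p, can be a canonical instance. *)
Definition Zpow of prime p := fun n : nat =>
  [pred x : rat | x / p%:R ^+ n \in Zlocal p].

Lemma Zpow_zmod n : zmod_closed (Zpow p_pr n).
Proof.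
have [_ sub_cl _] := Zlocal_subring.
split; first by rewrite inE /= mul0r (Zlocal_int 0).
by move=> x y px py; rewrite inE /= mulrBl; apply: sub_cl.
Qed.

HB.instance Definition _ n := GRing.isZmodClosed.Build rat (Zpow p_pr n) (Zpow_zmod n).

Lemma ZpowP n x : eqmod_local p n x 0 <-> x \in Zpow p_pr n.
Proof.
have p0 : p%:R ^+ n != 0 :> rat by rewrite expf_neq0 // p_neq0.
rewrite inE /=; split=> [[z zp]|xp]; rewrite ?subr0.
  by move->; rewrite mulrAC mulfV // mul1r.
by exists (x / p%:R ^+ n); rewrite // subr0 mulrC divfK.
Qed.

Lemma Zpow0 x : (x \in Zpow p_pr 0) = (x \in Zlocal p).
Proof. by rewrite inE /= expr0 divr1. Qed.

Lemma ZpowM m n x y :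
  x \in Zpow p_pr m -> y \in Zpow p_pr n -> x * y \in Zpow p_pr (m + n).
Proof.
have [_ _ mul_cl] := Zlocal_subring.
by rewrite !inE => xm yn; rewrite /= exprD invfM mulrACA; apply: mul_cl.
Qed.

Lemma ZpowMl n x y : x \in Zlocal p -> y \in Zpow p_pr n -> x * y \in Zpow p_pr n.
Proof. by rewrite -Zpow0 => /ZpowM/[apply]. Qed.

Lemma Zpow_int (a : int) : a%:~R \in Zpow p_pr 0.
Proof. by rewrite Zpow0 Zlocal_int. Qed.

Lemma Zpow_exp n : (p%:R ^+ n : rat) \in Zpow p_pr n.
Proof. by rewrite inE /= mulfV ?(Zlocal_int 1) // expf_neq0 // p_neq0. Qed.

Lemma Zlocal_nat n : (n%:R : rat) \in Zlocal p.
Proof. exact: (Zlocal_int n). Qed.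

Lemma ZlocalM x y : x \in Zlocal p -> y \in Zlocal p -> x * y \in Zlocal p.
Proof. by have [_ _] := Zlocal_subring; apply. Qed.

Lemma Zlocal_sign n : ((-1) ^+ n : rat) \in Zlocal p.
Proof.
rewrite -signr_odd; case: (odd n); first exact: (Zlocal_int (-1)).
exact: (Zlocal_int 1).
Qed.

Lemma Zpow_leq m n x : (m <= n)%N -> x \in Zpow p_pr n -> x \in Zpow p_pr m.
Proof.
move=> mn; rewrite !inE /= => xn.
have -> : x / p%:R ^+ m = p%:R ^+ (n - m) * (x / p%:R ^+ n).
  rewrite -{2}(subnK mn) exprD; field.
  by rewrite expf_neq0 ?p_neq0 //= expf_neq0 // p_neq0.
by rewrite -natrX; apply: ZlocalM => //; apply: Zlocal_nat.
Qed.

Lemma Zpow1_dvdz (a : int) : (p %| a)%Z -> a%:~R \in Zpow p_pr 1.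
Proof.
case/dvdzP => q ->; rewrite rmorphM -[X in Zpow _ X]add0n.
by apply: ZpowM; rewrite ?Zpow_int //; apply: (Zpow_exp 1).
Qed.

(** The link to [BC], which is phrased with numerators. *)
Lemma Zpow1_numq x : x \in Zpow p_pr 1 -> (p %| `|numq x|)%N.
Proof.
rewrite inE /= expr1 => /(ZlocalP _ p_pr)[a [b pb]] E.
have {}E : numq x * b%:Z = a * p%:Z * denq x.
  apply: (intr_inj (R := rat)); rewrite !rmorphM /= numqE -E.
  by have p0 := p_neq0; field.
have : (p %| `|numq x| * b)%N.
  by rewrite -[b]/(`|b%:Z|%N) -abszM E mulrAC abszM dvdn_mull.
by rewrite Euclid_dvdM // (negbTE pb) orbF.
Qed.

End Local.

(** * Rising factorials and Stirling numbers *)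

Definition rising (m : nat) : {poly rat} := \prod_(i < m) ('X + i.+1%:R%:P).

(** Lagrange's identity: both sides are (X+1)(X+2)...(X+m+1). *)
Lemma rising_shift m :
  ('X + 1) * (rising m \Po ('X + 1)) = ('X + m.+1%:R%:P) * rising m.
Proof.
transitivity (\prod_(i < m.+1) ('X + i.+1%:R%:P) : {poly rat}); last first.
  by rewrite big_ord_recr mulrC.
rewrite big_ord_recl; congr (_ * _).
rewrite /rising rmorph_prod; apply: eq_bigr => i _ /=.
by rewrite comp_polyD comp_polyX comp_polyC -addrA -polyC1 -polyCD nat1r.
Qed.

Lemma size_rising m : size (rising m) = m.+1.
Proof.
rewrite /rising (eq_bigr (fun i : 'I_m => 'X - (- i.+1%:R)%:P)); last first.
  by move=> i _; rewrite polyCN opprK.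
by rewrite size_prod_XsubC -[RHS]/(m.+1) /index_enum -enumT size_enum_ord.
Qed.

Lemma rising_lead m : (rising m)`_m = 1.
Proof.
suff /monicP : rising m \is monic by rewrite lead_coefE size_rising.
apply: rpred_prod => i _; rewrite -[_%:P]opprK -polyCN; exact: monicXsubC.
Qed.

Lemma rising_int m r : exists a : int, (rising m)`_r = a%:~R.
Proof.
pose g : {poly int} := \prod_(i < m) ('X + i.+1%:R%:P).
have -> : rising m = map_poly intr g.
  rewrite rmorph_prod /rising; apply: eq_bigr => i _ /=.
  by rewrite rmorphD /= map_polyX map_polyC /= mulrz_nat.
by exists g`_r; rewrite coef_map.
Qed.

Lemma coef_exp_X1 k s : (('X + 1 : {poly rat}) ^+ k)`_s = 'C(k, s)%:R.
Proof.
rewrite addrC exprDn coef_sum.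
have [sk|ks] := leqP s k.
  rewrite (bigD1 (Ordinal (sk : (s < k.+1)%N))) //= big1 ?addr0.
    by rewrite expr1n mul1r coefMn coefXn eqxx.
  move=> i; rewrite -val_eqE /= => /negbTE is'.
  by rewrite expr1n mul1r coefMn coefXn eq_sym is' mul0rn.
rewrite bin_small // big1 // => i _.
by rewrite expr1n mul1r coefMn coefXn gtn_eqF ?mul0rn // (leq_trans (ltn_ord i)).
Qed.

(** Compare the coefficients of X^s in [rising_shift], with [rising m] on the left expanded in
    powers of X+1. *)
Lemma rising_rec m s :
  \sum_(r < m.+1 | (s <= r)%N) 'C(r.+1, s)%:R * (rising m)`_r = m.+1%:R * (rising m)`_s.
Proof.
have /(congr1 (fun q : {poly rat} => q`_s)) := rising_shift m.
rewrite comp_polyE size_rising mulr_sumr coef_sum.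
rewrite mulrDl coefD coefXM mul_polyC coefZ.
under eq_bigr => i _ do rewrite -scalerAr -exprS coefZ coef_exp_X1 mulrC.
rewrite (bigID (fun r : 'I_m.+1 => (s <= r)%N)) /=.
(* Of these terms only r = s-1 survives; it cancels the coefficient that comes from X times
   [rising m] on the right. *)
have -> : \sum_(r < m.+1 | ~~ (s <= r)%N) 'C(r.+1, s)%:R * (rising m)`_r
    = if s == 0%N then 0 else (rising m)`_s.-1.
  case: s => [|s] /=; first by rewrite big_pred0.
  have [sm|ms] := ltnP s m.+1.
    rewrite (bigD1 (Ordinal sm)) /= -?ltnNge // binn mul1r big1 ?addr0 // => i.
    rewrite -ltnNge ltnS -val_eqE /= => /andP[is' ne].
    by rewrite bin_small ?mul0r // ltnS ltn_neqAle ne.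
  rewrite big1 ?nth_default ?size_rising // => i.
  rewrite -ltnNge => _; rewrite bin_small ?mul0r // ltnS.
  exact: leq_trans (ltn_ord i) _.
by rewrite addrC => /addrI.
Qed.

(* The k-th elementary symmetric function of 1, ..., p - 1. *)
Definition stirling (p k : nat) : rat := (rising p.-1)`_(p.-1 - k).

Lemma stirling0 p : stirling p 0 = 1.
Proof. by rewrite /stirling subn0 rising_lead. Qed.

(** This is [rising_rec] at s = p-1-k, summed in reverse. The term j = k has coefficient p-k, so
    that p-(p-k) = k remains on the left. *)
Lemma stirling_rec p k : (k < p)%N ->
  k%:R * stirling p k = \sum_(j < k) 'C(p - j, k.+1 - j)%:R * stirling p j.
Proof.
case: p => // m km; rewrite ltnS in km.
have := rising_rec m (m - k).
rewrite (reindex_inj rev_ord_inj) /=.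
rewrite (eq_bigl (fun j : 'I_m.+1 => (j <= k)%N)); last first.
  by move=> j /=; rewrite subSS; have := ltn_ord j; lia.
under eq_bigr => j _.
  have -> : (m.+1 - j.+1).+1 = (m.+1 - j)%N by have := ltn_ord j; lia.
  rewrite subSS; over.
rewrite -(big_ord_widen m.+1
  (fun j => 'C(m.+1 - j, m - k)%:R * (rising m)`_(m - j)) (n1 := k.+1)) //.
rewrite big_ord_recr /= addrC => /(canRL (addKr _)) E.
rewrite /stirling /=.
transitivity (m.+1%:R * (rising m)`_(m - k)
              - 'C(m.+1 - k, m - k)%:R * (rising m)`_(m - k)).
  rewrite -mulrBl subSn // binSn; congr (_ * _).
  by rewrite -natrB; [congr _%:R; lia|lia].
rewrite addrC -E; apply: eq_bigr => j _; congr (_%:R * _).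
by rewrite -[LHS]bin_sub; [congr 'C(_, _)|]; have := ltn_ord j; lia.
Qed.

(** * Binomial coefficients modulo p *)

Section Congruence.
Variables (p : nat) (p_pr : prime p).
Local Notation Zp := (Zpow p_pr).

(** Modulo p the upper entry p-j acts as -j, whence the sign. Double induction by Pascal's rule,
    starting from p | C(p,i) for 0 < i < p. *)
Lemma bin_congr j i : (j <= p)%N -> (i < p)%N ->
  'C(p - j, i)%:R - (-1) ^+ i * 'C((j + i).-1, i)%:R \in Zp 1.
Proof.
elim: j i => [|j IH] i jp ip.
  rewrite subn0; case: i ip => [|i] ip; first by rewrite !bin0 mul1r subrr rpred0.
  rewrite add0n (@bin_small i) // mulr0 subr0.
  by apply: (@Zpow1_dvdz _ _ 'C(p, i.+1)); apply: prime_dvd_bin.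
elim: i ip => [|i IHi] ip; first by rewrite !bin0 mul1r subrr rpred0.
have := IH i.+1 (ltnW jp) ip; have := IHi (ltnW ip).
have -> : (p - j = (p - j.+1).+1)%N by lia.
rewrite binS !addnS addSn /= binS natrD exprS => h1 h2.
apply: (eq_ind_r (fun z : rat => z \in Zp 1) (rpredB h2 h1)).
by rewrite natrD; ring.
Qed.

Lemma bin_congr1 k : (k < p)%N -> 'C(p.-1, k)%:R - (-1) ^+ k \in Zp 1.
Proof.
by move=> kp; have := bin_congr (prime_gt0 p_pr) kp; rewrite subn1 add1n binn mulr1.
Qed.

End Congruence.

(** * Stirling numbers modulo p^2 and Bernoulli numbers *)

Lemma bernoulliE k : (0 < k)%N ->
  k.+1%:R * bernoulli k = - \sum_(j < k) 'C(k.+1, j)%:R * bernoulli j.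
Proof.
move/bernoulli_rec; rewrite big_ord_recr /= binSn => /(canRL (addKr _)).
by rewrite addr0.
Qed.

Section BernoulliCongruence.
Variables (p : nat) (p_pr : prime p).
Local Notation Zp := (Zpow p_pr).

Lemma Zpow_invn n : (0 < n < p)%N -> (n%:R^-1 : rat) \in Zp 0.
Proof. by move=> /andP[n0 np]; rewrite Zpow0 Zlocal_invn // gtnNdvd. Qed.

Lemma Zpow_nat n : (n%:R : rat) \in Zp 0.
Proof. by rewrite Zpow0 Zlocal_nat. Qed.

(** Up to this index the recursion divides only by positive integers smaller than p. *)
Lemma bernoulli_local k : (k.+1 < p)%N -> bernoulli k \in Zp 0.
Proof.
elim/ltn_ind: k => -[|k] IH kp; first exact: (Zpow_nat 1).
have := bernoulliE (ltn0Sn k) => /(canRL (mulKf _)) ->; last by rewrite pnatr_eq0.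
apply: (@ZpowM _ _ 0 0); first by apply: Zpow_invn; rewrite kp.
rewrite rpredN; apply: rpred_sum => j _; apply: (@ZpowM _ _ 0 0); first exact: Zpow_nat.
by apply: IH => //; have := ltn_ord j; lia.
Qed.

(* Both sides satisfy the same recursion modulo p^2: it is stirling_rec on the
   left and the defining recursion of the Bernoulli numbers on the right. *)
Lemma stirling_congr k : (k.+2 < p)%N ->
  stirling p k.+1 - p%:R * ((-1) ^+ k * bernoulli k.+1 / k.+1%:R) \in Zp 2.
Proof.
elim/ltn_ind: k => k IH kp.
have nz m : m.+1%:R != 0 :> rat by rewrite pnatr_eq0.
pose b (i : nat) : rat := (-1) ^+ i * bernoulli i.+1 / i.+1%:R.
suff h : k.+1%:R * stirling p k.+1 - p%:R * ((-1) ^+ k * bernoulli k.+1) \in Zp 2.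
  have kinv : (k.+1%:R^-1 : rat) \in Zp 0 by apply: Zpow_invn; lia.
  apply: (eq_ind_r (fun z : rat => z \in Zp 2) (ZpowM kinv h)).
  by field; rewrite nat1r nz.
have p1 : (p%:R : rat) \in Zp 1 by have := Zpow_exp p_pr 1; rewrite expr1.
(* The difference of the two recursions, split into errors: p times a binomial error for j = 0, then
   for each i a binomial error times a Stirling number divisible by p, and an integer times the
   error known by induction. *)
have diff : k.+1%:R * stirling p k.+1 - p%:R * ((-1) ^+ k * bernoulli k.+1) =
    p%:R * (k.+2%:R^-1 * ('C(p.-1, k.+1)%:R - (-1) ^+ k.+1)) +
    \sum_(i < k) (
      ('C(p - i.+1, k.+1 - i)%:R - (-1) ^+ (k.+1 - i) * 'C(k.+1, i)%:R) * stirling p i.+1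
      + (-1) ^+ (k.+1 - i) * 'C(k.+1, i)%:R * (stirling p i.+1 - p%:R * b i)).
  rewrite stirling_rec; last by lia.
  rewrite big_ord_recl subn0 stirling0 mulr1 /= subn0.
  have -> : 'C(p, k.+2)%:R = p%:R * (k.+2%:R^-1 * 'C(p.-1, k.+1)%:R) :> rat.
    apply: (mulfI (nz k.+1)); rewrite -natrM -mul_bin_diag natrM.
    by field; rewrite -natrD nz.
  (* The Bernoulli recursion in the shape of [stirling_rec], by (i+1) C(k+2,i+1) = (k+2)
     C(k+1,i). *)
  have -> : bernoulli k.+1 =
      - (k.+2%:R^-1 + \sum_(i < k) 'C(k.+1, i)%:R * bernoulli i.+1 / i.+1%:R).
    apply: (mulfI (nz k.+1)); rewrite bernoulliE // big_ord_recl bin0 mul1r bernoulli0.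
    rewrite mulrN mulrDr mulfV // mulr_sumr; congr (- (_ + _)).
    apply: eq_bigr => i _; rewrite /= /bump /= add1n.
    have := mul_bin_diag k.+2 i => /(congr1 (fun n => n%:R : rat)).
    rewrite !natrM /= => E.
    have -> : 'C(k.+2, i.+1)%:R = k.+2%:R * 'C(k.+1, i)%:R / i.+1%:R :> rat.
      by rewrite E mulrC mulKf.
    by ring.
  have -> : \sum_(i < k) (
      ('C(p - i.+1, k.+1 - i)%:R - (-1) ^+ (k.+1 - i) * 'C(k.+1, i)%:R) * stirling p i.+1
      + (-1) ^+ (k.+1 - i) * 'C(k.+1, i)%:R * (stirling p i.+1 - p%:R * b i))
      = \sum_(i < k) 'C(p - i.+1, k.+1 - i)%:R * stirling p i.+1
        + p%:R * (-1) ^+ k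
          * \sum_(i < k) 'C(k.+1, i)%:R * bernoulli i.+1 / i.+1%:R :> rat.
    rewrite mulr_sumr -big_split; apply: eq_bigr => i _ /=.
    have E : (-1) ^+ (k.+1 - i) * (-1) ^+ i = - (-1) ^+ k :> rat.
      by rewrite -exprD subnK ?exprS ?mulN1r // ltnW // ltnS ltnW.
    have sub (s t C D a c e q : rat) : s * t = - q ->
        (D - s * C) * a + s * C * (a - p%:R * (t * c / e)) =
        D * a + p%:R * q * (C * c / e).
      by move=> st; rewrite -[q]opprK -st; ring.
    exact: (sub _ _ _ _ _ _ _ _ E).
  under [X in _ + X - _]eq_bigr => i _ do rewrite /= /bump /= add1n.
  by rewrite exprS; ring.
rewrite diff; apply: rpredD.
  apply: (@ZpowM _ _ 1 1) => //.
  apply: (@ZpowM _ _ 0 1); first by apply: Zpow_invn; lia.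
  by apply: bin_congr1; lia.
apply: rpred_sum => i _; have ik := ltn_ord i.
have hi : stirling p i.+1 - p%:R * b i \in Zp 2 by apply: IH; lia.
have hb : p%:R * b i \in Zp 1.
  apply: (@ZpowM _ _ 1 0) => //; apply: (@ZpowM _ _ 0 0); last by apply: Zpow_invn; lia.
  apply: (@ZpowM _ _ 0 0); first by rewrite Zpow0 Zlocal_sign.
  by apply: bernoulli_local; lia.
apply: rpredD.
  apply: (@ZpowM _ _ 1 1); last first.
    by rewrite -[stirling _ _](subrK (p%:R * b i)) rpredD // (Zpow_leq _ hi).
  have := @bin_congr _ p_pr i.+1 (k.+1 - i).
  have -> : ((i.+1 + (k.+1 - i)).-1 = k.+1)%N by lia.
  by rewrite bin_sub; [apply; lia|lia].
apply: (@ZpowM _ _ 0 2) => //; apply: (@ZpowM _ _ 0 0); last exact: Zpow_nat.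
by rewrite Zpow0 Zlocal_sign.
Qed.

End BernoulliCongruence.

(** * Generating polynomial of the values of the e_r, and its reflection *)

(** Monomials with a variable beyond the list contribute 0, which leaves the value of a polynomial
    in finitely many variables. Linearity and multiplicativity of the evaluation follow from
    this. *)
Lemma sfeval_restr (f : symfun) (a : seq rat) n : size a = n ->
  sfeval f a = (restr n f).@[fun i : 'I_n => a`_i].
Proof.
move=> <-; set n0 := size a.
rewrite /sfeval mevalE.
pose F (m : {mset nat}%mset) := sfval f m * \prod_(i <- (m : {mset nat}%mset)) a`_i.
have Fm (m : 'X_{1..n0}) : F (mon_of m) = (restr n0 f)@_m * \prod_(i < n0) a`_i ^+ m i.
  rewrite /F mcoeff_restr; congr (_ * _).
  rewrite (perm_big _ (perm_eq_seq_mset _)) big_flatten big_map big_enum /=.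
  by apply: eq_bigr => i _; rewrite big_nseq -Monoid.iteropE.
transitivity (\sum_(m \in (@mon_of n0) @` [set` msupp (restr n0 f)]) F m).
  apply/esym/fsbig_widen => // m [_ /= h].
  apply/eqP; apply: contra_notT h => nz.
  have m0 i : (n0 <= i)%N -> m i = 0%N.
    move=> ni; apply/eqP; rewrite mset_eq0; apply: contra nz => im.
    have ai : a`_i = 0 by exact: nth_default.
    by rewrite /F (perm_big _ (perm_to_rem im)) big_cons /= ai mul0r mulr0.
  exists [multinom m i | i < n0]; last exact: mon_of_surj.
  rewrite /= mcoeff_msupp mcoeff_restr mon_of_surj //.
  by apply: contra nz; rewrite /F => /eqP->; rewrite mul0r.
rewrite fsbig_image; last by move=> x y _ _; apply: mon_of_inj.
rewrite -fsbig_seq ?msupp_uniq //.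
by apply: eq_bigr => m _; rewrite Fm.
Qed.

Lemma meval_mesym n (v : 'I_n -> rat) r :
  (mesym n rat r).@[v] = (\prod_(i < n) (1 + v i *: 'X))`_r.
Proof.
under eq_bigr => i _ do rewrite addrC.
rewrite bigA_distr coef_sum /mesym raddf_sum /= big_mkcond /=.
apply: eq_bigr => h _.
rewrite -big_mkcond /= scaler_prod prodr_const coefZ coefXn eq_sym.
case: eqP => _; rewrite ?mulr0 // mulr1 rmorph_prod.
by apply: eq_bigr => i _; rewrite /= mevalXU.
Qed.

Lemma coef_comp_poly_wide (P q : {poly rat}) N k : (size P <= N)%N ->
  (P \Po q)`_k = \sum_(i < N) P`_i * (q ^+ i)`_k.
Proof.
move=> PN; rewrite coef_comp_poly (big_ord_widen N (fun i => P`_i * (q ^+ i)`_k) PN).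
rewrite big_mkcond; apply: eq_bigr => i _; case: ltnP => // Pi.
by rewrite nth_default ?mul0r.
Qed.

Lemma coef_comp_scaleX (P : {poly rat}) c r :
  (P \Po (c *: 'X))`_r = c ^+ r * P`_r.
Proof.
elim/poly_ind: P r => [|P d IH] r; first by rewrite comp_poly0 !coef0 mulr0.
rewrite comp_poly_MXaddC -scalerAr !coefD coefZ !coefMX !coefC.
case: r => [|r] /=; first by rewrite mulr0 !add0r mul1r.
by rewrite !addr0 IH exprS mulrA.
Qed.

Definition harmonic_gf (p : nat) : {poly rat} :=
  \prod_(i < p.-1) (1 + (p%:R / i.+1%:R) *: 'X).

Lemma sfeval_esym p r : sfeval (e_ r) (harmonic_point p) = (harmonic_gf p)`_r.
Proof.
have hs : size (harmonic_point p) = p.-1 by rewrite size_map size_iota.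
rewrite (sfeval_restr _ hs) restr_esym meval_mesym.
apply: (congr1 (fun P : {poly rat} => P`_r)); apply: eq_bigr => i _; congr (1 + _ *: _).
by rewrite (nth_map 0%N) ?size_iota // nth_iota // add1n.
Qed.

Lemma harmonic_gf_rising p :
  harmonic_gf p = (p.-1)`!%:R^-1 *: (rising p.-1 \Po (p%:R *: 'X)).
Proof.
have -> : (p.-1)`!%:R^-1 = \prod_(i < p.-1) i.+1%:R^-1 :> rat.
  elim: (p.-1) => [|m IH]; first by rewrite big_ord0 invr1.
  by rewrite big_ord_recr /= factS mulnC natrM invfM IH.
rewrite /rising rmorph_prod -scaler_prod; apply: eq_bigr => i _ /=.
rewrite comp_polyD comp_polyX comp_polyC scalerDr addrC.
by rewrite -alg_polyC !scalerA mulVf ?pnatr_eq0 // scale1r [_ / _]mulrC.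
Qed.

Lemma coef_harmonic_gf p r :
  (harmonic_gf p)`_r = (p.-1)`!%:R^-1 * (p%:R ^+ r * (rising p.-1)`_r).
Proof. by rewrite harmonic_gf_rising coefZ coef_comp_scaleX. Qed.

(** At -1-X the factor with denominator i is -(p-i)/i times the factor at X with denominator p-i.
    The constants multiply to (-1)^(p-1) = 1. *)
Lemma harmonic_gf_reflect p : odd p ->
  harmonic_gf p \Po (- ('X + 1)) = harmonic_gf p.
Proof.
case: p => // m /= /negbTE om; rewrite /harmonic_gf /=.
have nz i : i.+1%:R != 0 :> rat by rewrite pnatr_eq0.
have factor (a b : rat) : a != 0 -> b != 0 ->
    1 + ((a + b) / b) *: - ('X + 1) = (- a / b) *: (1 + ((a + b) / a) *: 'X).
  move=> a0 b0; rewrite scalerDr scalerA.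
  have -> : - a / b * ((a + b) / a) = - ((a + b) / b) by field; rewrite a0 b0.
  have -> : - a / b = 1 - (a + b) / b by field.
  by rewrite scalerN scalerDr opprD scalerBl scale1r scaleNr addrA addrAC.
rewrite rmorph_prod /=.
transitivity (\prod_(i < m) ((- (rev_ord i).+1%:R / i.+1%:R) *:
    (1 + (m.+1%:R / (rev_ord i).+1%:R) *: 'X)) : {poly rat}).
  apply: eq_bigr => i _; rewrite comp_polyD comp_polyZ comp_polyX.
  rewrite -[1 in LHS]polyC1 comp_polyC polyC1.
  have -> : m.+1%:R = (rev_ord i).+1%:R + i.+1%:R :> rat.
    by rewrite -natrD; congr _%:R; have := ltn_ord i; rewrite /=; lia.
  exact: factor.
rewrite scaler_prod [X in X *: _](_ : _ = 1) ?scale1r; last first.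
  rewrite big_split /= prodrN card_ord -signr_odd om mul1r.
  have -> : \prod_(i < m) (rev_ord i).+1%:R = \prod_(i < m) i.+1%:R :> rat.
    by rewrite [RHS](reindex_inj rev_ord_inj).
  rewrite -big_split /=.
  by apply: big1 => i _; rewrite mulfV.
by rewrite [RHS](reindex_inj rev_ord_inj).
Qed.

(** Coefficients of X^k in [harmonic_gf_reflect]. The free bound N lets the sum be matched with the
    one in [beta_lift]. *)
Lemma harmonic_gf_relation p k N : odd p -> (size (harmonic_gf p) <= N)%N ->
  (harmonic_gf p)`_k = \sum_(j < N) (-1) ^+ j * 'C(j, k)%:R * (harmonic_gf p)`_j.
Proof.
move=> op sN; rewrite -[in LHS](harmonic_gf_reflect op) (coef_comp_poly_wide _ _ sN).
apply: eq_bigr => j _.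
rewrite [in LHS]exprNn -signr_odd -[X in _ = X * _ * _]signr_odd -mulrA !mulr_sign.
by case: (odd j); rewrite ?coefN coef_exp_X1; ring.
Qed.

(** * Powers of p in the values of the e_r *)

Section HarmonicValues.
Variables (p : nat) (p_pr : prime p).
Local Notation Zp := (Zpow p_pr).

Lemma Zpow_divp n x : x \in Zp n.+1 -> x / p%:R \in Zp n.
Proof. by rewrite !inE /= exprS invfM mulrA. Qed.

Lemma Zpow_inv_fact : ((p.-1)`!%:R^-1 : rat) \in Zp 0.
Proof.
rewrite Zpow0 Zlocal_invn //; have := prime_gt1 p_pr => p1; have := p_pr.
rewrite (Wilson p1) -addn1 => pF1; apply/negP => /dvdn_addr E.
by move: pF1; rewrite E dvdn1 gtn_eqF.
Qed.

Lemma stirling_Zpow k : (k.+2 < p)%N -> stirling p k.+1 \in Zp 1.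
Proof.
move=> kp; have := stirling_congr p_pr kp => /(Zpow_leq (ltnW (ltnSn 1))) h.
rewrite -[stirling _ _](subrK (p%:R * ((-1) ^+ k * bernoulli k.+1 / k.+1%:R))).
rewrite rpredD //; apply: (@ZpowM _ _ 1 0); first exact: (Zpow_exp p_pr 1).
apply: (@ZpowM _ _ 0 0); last by apply: Zpow_invn; lia.
apply: (@ZpowM _ _ 0 0); first by rewrite Zpow0 Zlocal_sign.
by apply: bernoulli_local; lia.
Qed.

Lemma harmonic_gf_Zpow r : (harmonic_gf p)`_r \in Zp r.
Proof.
rewrite coef_harmonic_gf; apply: (@ZpowM _ _ 0 r); first exact: Zpow_inv_fact.
have [a ->] := rising_int p.-1 r; rewrite -[r in Zp r]addn0.
by apply: ZpowM; [apply: Zpow_exp|apply: Zpow_int].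
Qed.

Lemma harmonic_gf_stirling r k : (r + k = p.-1)%N ->
  (harmonic_gf p)`_r = (p.-1)`!%:R^-1 * (p%:R ^+ r * stirling p k).
Proof. by move=> E; rewrite coef_harmonic_gf /stirling -E addnK. Qed.

Lemma harmonic_gf_ZpowS r : (0 < r)%N -> (r.+1 < p)%N -> (harmonic_gf p)`_r \in Zp r.+1.
Proof.
(* The index p-1-r, written as a successor to fit [stirling_Zpow]. *)
move=> r0 rp; rewrite (@harmonic_gf_stirling r (p - r.+2).+1); last by lia.
apply: (@ZpowM _ _ 0 r.+1); first exact: Zpow_inv_fact.
rewrite -[in Zp _]addn1; apply: ZpowM; first exact: Zpow_exp.
by apply: stirling_Zpow; lia.
Qed.

(** Put k+1 = p-1-r. By [stirling_congr] with k odd, c_r/p is -B_(k+1)/(k+1) modulo p; then (p-1)! =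
    -1 (Wilson) and k+1 = -(r+1) modulo p. *)
Lemma harmonic_gf_bernoulli r : (0 < r)%N -> ~~ odd r -> odd p -> (r.+1 < p)%N ->
  (harmonic_gf p)`_r / p%:R ^+ r.+1 + bernoulli (p - r.+1) / r.+1%:R \in Zp 1.
Proof.
move=> r0 er op rp.
have [k kE] : exists k, (p = k.+1 + r.+1)%N by exists (p - r.+2)%N; lia.
have ok : odd k by move: op; rewrite kE addSn addnS /= negbK oddD (negbTE er) addbF.
have -> : (p - r.+1 = k.+1)%N by lia.
rewrite (@harmonic_gf_stirling r k.+1); last by lia.
have kp : (k.+2 < p)%N by lia.
have := stirling_congr p_pr kp; rewrite -signr_odd ok expr1 mulN1r.
have nz m : m.+1%:R != 0 :> rat by rewrite pnatr_eq0.
have := p_neq0 p_pr.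
have F0 : (p.-1)`!%:R != 0 :> rat by rewrite pnatr_eq0 -lt0n fact_gt0.
have Fp := Zpow_inv_fact.
have W : (p.-1)`!.+1%:R \in Zp 1.
  apply: (@Zpow1_dvdz _ _ (p.-1)`!.+1).
  by have := p_pr; rewrite {1}(Wilson (prime_gt1 p_pr)).
set F : rat := _%:R in F0 Fp *; rewrite -natr1 -/F in W.
set s := stirling _ _; set B := bernoulli _; set P : rat := p%:R => P0 h.
have PE : P = k.+1%:R + r.+1%:R by rewrite -natrD -kE.
(* An exact identity based on P = (k+1)+(r+1): the first term carries the error of [stirling_congr],
   the second a multiple of P - (k+1)(F+1), where p divides F+1. *)
have -> : F^-1 * (P ^+ r * s) / P ^+ r.+1 + B / r.+1%:R =
    F^-1 * ((s - P * (- B / k.+1%:R)) / P) -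
    B * (F^-1 * k.+1%:R^-1 * r.+1%:R^-1) * (P - k.+1%:R * (F + 1)).
  have Pr0 : P ^+ r != 0 by rewrite expf_neq0.
  have {1}-> : B / r.+1%:R = B * (F^-1 * k.+1%:R^-1 * r.+1%:R^-1) * (F * k.+1%:R).
    move: (nz k) (nz r); move: (k.+1%:R) (r.+1%:R) => a b a0 b0.
    by field; rewrite a0 b0 F0.
  rewrite exprS; move: (nz k) (nz r) PE; move: (k.+1%:R) (r.+1%:R) => a b a0 b0 PE.
  have -> : b = P - a by rewrite PE addrC addKr.
  have : P - a != 0 by rewrite PE addrC addKr.
  by move=> Pa0; field; rewrite -/P -/F Pa0 P0 Pr0 F0 a0.
apply: rpredB.
  by apply: (@ZpowM _ _ 0 1) => //; apply: Zpow_divp.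
apply: (@ZpowM _ _ 0 1); last first.
  apply: rpredB; first exact: (Zpow_exp p_pr 1).
  by apply: (@ZpowM _ _ 0 1) => //; apply: Zpow_nat.
apply: (@ZpowM _ _ 0 0); first by apply: bernoulli_local; lia.
apply: (@ZpowM _ _ 0 0); last by apply: Zpow_invn; lia.
by apply: (@ZpowM _ _ 0 0) => //; apply: Zpow_invn; lia.
Qed.

End HarmonicValues.

(** * Divisibility of values for almost all primes *)

Definition heval (p : nat) (f : symfun) : rat := sfeval f (harmonic_point p).

Lemma hevalE p f :
  heval p f = (restr (size (harmonic_point p)) f).@[fun i => (harmonic_point p)`_i].
Proof. exact: sfeval_restr. Qed.

Lemma heval_is_linear p : linear_for *%R (heval p).
Proof. by move=> c f g; rewrite !hevalE linearP mevalD mevalZ. Qed.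

Lemma heval_is_monoid p : monoid_morphism (heval p).
Proof. by split=> [|f g]; rewrite !hevalE ?rmorph1 ?meval1 // rmorphM mevalM. Qed.

HB.instance Definition _ p :=
  GRing.isLinear.Build rat symfun rat *%R (heval p) (heval_is_linear p).
HB.instance Definition _ p :=
  GRing.isMonoidMorphism.Build symfun rat (heval p) (heval_is_monoid p).

Lemma heval_esym p r : heval p (e_ r) = (harmonic_gf p)`_r.
Proof. exact: sfeval_esym. Qed.

(** For varying n a multiplicative filtration of Lambda ([evdivM]), containing the one by [Hideal]
    ([evdiv_Hideal]). *)
Definition evdiv (n : nat) (f : symfun) : Prop :=
  exists N, forall p (pp : prime p), (N <= p)%N -> heval p f \in Zpow pp n.

Lemma evdivP n f :
  (exists N : nat, forall p : nat, prime p -> (N <= p)%N ->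
    eqmod_local p n (sfeval f (harmonic_point p)) 0) <-> evdiv n f.
Proof. by split=> -[N h]; exists N => p pp Np; apply/ZpowP/h. Qed.

Lemma evdiv0 n : evdiv n 0.
Proof. by exists 0%N => p pp _; rewrite linear0 rpred0. Qed.

Lemma evdivD n f g : evdiv n f -> evdiv n g -> evdiv n (f + g).
Proof.
move=> [N hf] [M hg]; exists (maxn N M) => p pp; rewrite geq_max => /andP[Np Mp].
by rewrite linearD rpredD ?hf ?hg.
Qed.

Lemma evdivM m n f g : evdiv m f -> evdiv n g -> evdiv (m + n) (f * g).
Proof.
move=> [N hf] [M hg]; exists (maxn N M) => p pp; rewrite geq_max => /andP[Np Mp].
by rewrite rmorphM; apply: ZpowM; [apply: hf|apply: hg].
Qed.

Lemma evdiv_leq m n f : (m <= n)%N -> evdiv n f -> evdiv m f.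
Proof. by move=> mn [N h]; exists N => p pp Np; apply: Zpow_leq mn (h _ _ Np). Qed.

(** Finitely many rational coefficients have bounded denominators, so they only raise the threshold
    for p. *)
Lemma Zlocal_large (s : seq rat) :
  exists N, forall p, prime p -> (N <= p)%N -> {in s, forall c, c \in Zlocal p}.
Proof.
exists (\max_(c <- s) `|denq c|).+1 => p pp Np c cs.
rewrite /Zlocal inE /= gtnNdvd // ?absz_gt0 ?denq_neq0 //.
by apply: leq_trans Np; rewrite ltnS (big_rem c) //= leq_maxl.
Qed.

Lemma evdivZ n c f : evdiv n f -> evdiv n (c *: f).
Proof.
move=> [N hf]; have [M hc] := Zlocal_large [:: c].
exists (maxn N M) => p pp; rewrite geq_max => /andP[Np Mp].
by rewrite linearZ /=; apply: ZpowMl; rewrite ?hf // hc ?mem_head.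
Qed.

Lemma evdiv_esym k : (0 < k)%N -> evdiv k.+1 (e_ k).
Proof.
by move=> k0; exists k.+2 => p pp kp; rewrite heval_esym harmonic_gf_ZpowS.
Qed.

Lemma evdiv_emonomial s : all (leq 1) s -> evdiv (Hdegree s) (emonomial s).
Proof.
rewrite /emonomial /Hdegree; elim: s => [|k s IH] /=.
  by rewrite !big_nil; exists 0%N => p pp _; rewrite rmorph1 (Zpow_nat pp 1).
by rewrite !big_cons => /andP[k0 /IH]; apply: evdivM; apply: evdiv_esym.
Qed.

Lemma evdiv_ecomb n l : all (fun x => all (leq 1) x.2 && (n <= Hdegree x.2)%N) l ->
  evdiv n (ecomb l).
Proof.
move=> /allP lP; rewrite /ecomb big_seq.
apply: (big_ind (evdiv n)); [exact: evdiv0|exact: evdivD|].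
move=> x /lP /andP[x1 xn]; apply: evdivZ.
exact: evdiv_leq xn (evdiv_emonomial x1).
Qed.

Lemma evdiv_Hideal n f : f \in Hideal n -> evdiv n f.
Proof. by case/HidealP => l lP ->; apply: evdiv_ecomb. Qed.

Lemma evdiv_symfun f : evdiv 0 f.
Proof.
have [l lP ->] := esym_generate f; apply: evdiv_ecomb.
by apply: sub_all lP => x ->.
Qed.

(** * The elements beta_k and their ideal *)

(** A representative of [beta n k] in Lambda: terms with j < k have a zero binomial coefficient, and
    e_j with j > n vanishes in the quotient. *)
Definition beta_lift (n k : nat) : symfun :=
  e_ k + \sum_(j < n.+1) ((-1) ^+ j.+1 * 'C(j, k)%:R) *: e_ j.

(** By [harmonic_gf_relation] the value of e_k cancels the terms with j <= n; what remains has j > n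
    and is divisible by p^j. *)
Lemma evdiv_beta_lift n k : evdiv n (beta_lift n k).
Proof.
(* The threshold 3 makes p odd, as the reflection requires. *)
exists 3 => p pp p3; rewrite linearD linear_sum /= heval_esym.
have op : odd p by case: (even_prime pp) p3 => // ->.
pose N := maxn (size (harmonic_gf p)) n.+1.
rewrite (harmonic_gf_relation k op (leq_maxl _ n.+1)) -/N.
rewrite (big_ord_widen N
  (fun j => heval p (((-1) ^+ j.+1 * 'C(j, k)%:R) *: e_ j)) (leq_maxr _ _)).
rewrite (bigID (fun j : 'I_N => (j < n.+1)%N)) /= addrAC -big_split /= big1 ?add0r.
  apply: rpred_sum => j; rewrite -leqNgt => nj; apply: ZpowMl.
    by apply: ZlocalM => //; [apply: Zlocal_sign|apply: Zlocal_nat].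
  exact: Zpow_leq (ltnW nj) (harmonic_gf_Zpow pp j).
by move=> j _; rewrite linearZ /= heval_esym exprS mulN1r !mulNr subrr.
Qed.

Section SymQuot.
Variable n : nat.

HB.instance Definition _ := GRing.RMorphism.copy (symbar n)
  (\pi_({ideal_quot idealH n})%qT : symfun -> symquot n).

Lemma beta_liftE k : symbar n (beta_lift n k) = beta n k.
Proof.
rewrite rmorphD rmorph_sum /=; congr (_ + _).
pose F j := (-1) ^+ j.+1 * 'C(j, k)%:R * symbar n (e_ j).
transitivity (\sum_(j \in `I_n.+1) F j).
  rewrite -fsbig_ord; apply: eq_bigr => j _.
  rewrite /F -scalerA scaler_nat -signr_odd -[X in _ = X * _ * _]signr_odd.
  rewrite -mulrA mulr_natl scaler_sign mulr_sign.
  by case: ifP => _; rewrite ?rmorphN rmorphMn.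
transitivity (\sum_(j \in [set: nat]) F j).
  apply: fsbig_widen => // j [_ /negP]; rewrite -leqNgt => nj; rewrite /F /=.
  suff /eqP-> : symbar n (e_ j) == 0 by rewrite mulr0.
  by rewrite symbar_eq0; apply: esym_Hideal; lia.
apply/esym/fsbig_widen => // j [_ /negP]; rewrite -ltnNge => jk.
by rewrite /F /= bin_small // mulr0 mul0r.
Qed.

(** The preimage of I^[n] in Lambda, so that the reduction can be carried out on symmetric
    functions. *)
Definition beta_ideal (f : symfun) : Prop := gen_ideal (range (beta n)) (symbar n f).

Lemma beta_idealD f g : beta_ideal f -> beta_ideal g -> beta_ideal (f + g).
Proof.
move=> [l lB lE] [s sB sE]; exists (l ++ s); last by rewrite rmorphD /= lE sE big_cat.
by move=> y; rewrite mem_cat => /orP[/lB|/sB].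
Qed.

Lemma beta_idealM f g : beta_ideal g -> beta_ideal (f * g).
Proof.
move=> [l lB lE]; exists [seq (symbar n f * y.1, y.2) | y <- l].
  by move=> _ /mapP[y yl ->] /=; apply: lB.
by rewrite rmorphM /= lE mulr_sumr big_map; apply: eq_bigr => y _; rewrite mulrA.
Qed.

Lemma beta_idealZ c f : beta_ideal f -> beta_ideal (c *: f).
Proof. by rewrite -mulr_algl; apply: beta_idealM. Qed.

Lemma beta_ideal_lift k : beta_ideal (beta_lift n k).
Proof.
exists [:: (1, beta n k)]; last by rewrite big_seq1 mul1r beta_liftE.
by move=> y; rewrite inE => /eqP->; exists k.
Qed.

Hypothesis n_gt0 : (0 < n)%N.

Lemma symbarP f : (symbar n f == 0) = (f \in Hideal n).
Proof. by rewrite symbar_eq0 prednK. Qed.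

Lemma beta_ideal_Hideal f : f \in Hideal n -> beta_ideal f.
Proof. by rewrite -symbarP => /eqP f0; exists [::]; rewrite // big_nil f0. Qed.

(** Induction on the number of generators used: subtract a lifted multiple of one [beta_lift] at a
    time, until an element of [Hideal n] is left. *)
Lemma beta_ideal_evdiv f : beta_ideal f -> evdiv n f.
Proof.
case=> l; elim: l f => [|y l IH] f lB.
  by rewrite big_nil => /eqP; rewrite symbarP; apply: evdiv_Hideal.
have [k _ kE] := lB y (mem_head y l).
rewrite big_cons -kE => fE.
pose a := repr y.1; have aE : symbar n a = y.1 by exact: reprK.
rewrite -[f](subrK (a * beta_lift n k)); apply: evdivD.
  apply: IH; first by move=> z zl; apply: lB; rewrite inE zl orbT.
  by rewrite rmorphB rmorphM /= beta_liftE fE aE addrC addKr.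
exact: (@evdivM 0) (evdiv_symfun a) (evdiv_beta_lift n k).
Qed.

End SymQuot.

(* The variable of index i stands for e_(2i+2), whose H-degree 2i+3 is the
   weight of the i-th variable in BC. *)
Definition even_esym n (P : {mpoly rat[n]}) : symfun :=
  mmap (in_alg symfun) (fun i => e_ (2 * i + 2)) P.

Definition weight n (m : 'X_{1..n}) : nat := \sum_(i < n) m i * (2 * i + 3).

Definition reducible n (f : symfun) : Prop :=
  exists P : {mpoly rat[n]}, beta_ideal n (f - even_esym P).

(** * Elimination of the e_k of odd index *)

Section Elimination.
Variable n : nat.
Hypothesis n_gt0 : (0 < n)%N.

HB.instance Definition _ := GRing.RMorphism.copy (@even_esym n)
  (mmap (in_alg symfun) (fun i : 'I_n => e_ (2 * i + 2))).

Lemma beta_ideal0 : beta_ideal n 0.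
Proof. by exists [::]; rewrite // big_nil rmorph0. Qed.

Lemma reducible_even (P : {mpoly rat[n]}) : reducible n (even_esym P).
Proof. by exists P; rewrite subrr; apply: beta_ideal0. Qed.

Lemma reducible_ideal f : beta_ideal n f -> reducible n f.
Proof. by exists (0 : {mpoly rat[n]}); rewrite rmorph0 subr0. Qed.

Lemma reducibleD f g : reducible n f -> reducible n g -> reducible n (f + g).
Proof.
move=> [P hP] [Q hQ]; exists (P + Q); rewrite rmorphD opprD addrACA.
exact: beta_idealD.
Qed.

Lemma reducibleM f g : reducible n f -> reducible n g -> reducible n (f * g).
Proof.
move=> [P hP] [Q hQ]; exists (P * Q); rewrite rmorphM.
have -> : f * g - even_esym P * even_esym Q =
    g * (f - even_esym P) + even_esym P * (g - even_esym Q) by ring.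
by apply: beta_idealD; apply: beta_idealM.
Qed.

Lemma reducibleZ c f : reducible n f -> reducible n (c *: f).
Proof.
rewrite -mulr_algl; apply: reducibleM; exists c%:MP.
by rewrite /even_esym mmapC subrr; apply: beta_ideal0.
Qed.

(** For odd k below n, e_k has coefficient 1 + (-1)^(k+1) = 2 in [beta_lift n k], and all other
    terms have j > k. *)
Lemma reducible_esym k : (0 < k)%N -> reducible n (e_ k).
Proof.
(* Downward induction on k, with d bounding n-k; for k >= n, e_k lies in [Hideal n]. *)
move=> k0; have [d] : exists d, (n <= k + d)%N by exists n; lia.
elim: d k k0 => [|d IH] k k0 kd.
  by apply: reducible_ideal; apply: beta_ideal_Hideal => //; apply: esym_Hideal; lia.
have [nk|kn] := leqP n k; first by apply: IH; lia.
have [ok|ek] := boolP (odd k); last first.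
  have kn2 : (k./2.-1 < n)%N by lia.
  have -> : e_ k = even_esym 'X_(Ordinal kn2); last exact: reducible_even.
  rewrite /even_esym mmapX mmap1U /=; congr e_.
  by have := odd_double_half k; rewrite (negbTE ek); lia.
have -> : e_ k = 2^-1 *: (beta_lift n k -
    \sum_(j < n.+1 | j != k :> nat) ((-1) ^+ j.+1 * 'C(j, k)%:R) *: e_ j).
  rewrite /beta_lift (bigD1 (Ordinal (leqW kn))) //= addrA addrK.
  rewrite binn mulr1 exprS -signr_odd ok mulN1r opprK scale1r.
  by rewrite -mulr2n -scaler_nat scalerA mulVf ?scale1r.
apply: reducibleZ; apply: reducibleD.
  by apply: reducible_ideal; apply: beta_ideal_lift.
rewrite -scaleN1r; apply: reducibleZ.
apply: (big_ind (reducible n)); [|exact: reducibleD|].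
  by apply: reducible_ideal; exact: beta_ideal0.
move=> j jk; have [lt|ge] := ltnP j k.
  by rewrite bin_small // mulr0 scale0r; apply: reducible_ideal; exact: beta_ideal0.
by apply: reducibleZ; apply: IH; lia.
Qed.

Lemma symfun_reducible f : reducible n f.
Proof.
have [l /allP lP ->] := esym_generate f; rewrite /ecomb big_seq.
apply: (big_ind (reducible n)); [|exact: reducibleD|].
  by apply: reducible_ideal; exact: beta_ideal0.
move=> x /lP; elim: x.2 x.1 => [|k s IH] c /=.
  rewrite /emonomial big_nil => _; apply: reducibleZ.
  by rewrite -(rmorph1 (@even_esym n)); apply: reducible_even.
move=> /andP[k0 /IH] h; rewrite /emonomial big_cons -/(emonomial s).
by rewrite scalerAr; apply: reducibleM => //; apply: reducible_esym.
Qed.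

Lemma even_esymE (P : {mpoly rat[n]}) :
  even_esym P = \sum_(m <- msupp P) P@_m *: \prod_(i < n) e_ (2 * i + 2) ^+ m i.
Proof. by apply: eq_bigr => m _; rewrite mulr_algl. Qed.

Lemma even_esym_Hideal (P : {mpoly rat[n]}) :
  {in msupp P, forall m, n <= weight m}%N -> beta_ideal n (even_esym P).
Proof.
move=> wP; rewrite even_esymE big_seq.
apply: (big_ind (beta_ideal n)); [exact: beta_ideal0|exact: beta_idealD|].
move=> m /wP nm; apply: beta_idealZ; apply: beta_ideal_Hideal => //.
pose s := flatten [seq nseq (m i) (2 * i + 2)%N | i : 'I_n].
apply/HidealP; exists [:: (1, s)]; last first.
  rewrite /ecomb big_seq1 scale1r /emonomial big_flatten big_map big_enum.
  by apply: eq_bigr => i _; rewrite big_nseq -Monoid.iteropE.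
rewrite /= andbT; apply/andP; split.
  by apply/allP => k /flattenP[_ /mapP[i _ ->]] /nseqP[-> _]; lia.
apply: leq_trans nm _; rewrite /Hdegree big_flatten big_map big_enum /weight.
apply: leq_sum => i _; rewrite big_nseq iter_addn addn0 mulnC leq_mul //; lia.
Qed.

End Elimination.

(** * Least weight and forms in Bernoulli numbers *)

(** Congruence modulo p between p-integral numbers is stable under products. It serves to replace
    scaled values of the e_r by Bernoulli numbers inside a monomial. *)
Lemma Zpow1_prod p (pp : prime p) n (t u : 'I_n -> rat) (m : 'X_{1..n}) :
    (forall i, t i \in Zpow pp 0) -> (forall i, u i \in Zpow pp 0) ->
    (forall i, t i - u i \in Zpow pp 1) ->
  \prod_(i < n) t i ^+ m i - \prod_(i < n) u i ^+ m i \in Zpow pp 1.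
Proof.
move=> t0 u0 tu.
pose R x y := [&& x \in Zpow pp 0, y \in Zpow pp 0 & x - y \in Zpow pp 1].
have R1 : R 1 1 by rewrite /R (Zpow_nat pp 1) subrr rpred0.
have RM x1 x2 y1 y2 : R x1 x2 -> R y1 y2 -> R (x1 * y1) (x2 * y2).
  move=> /and3P[a1 a2 a12] /and3P[b1 b2 b12].
  rewrite /R (@ZpowM _ pp 0 0) // (@ZpowM _ pp 0 0) //=.
  have -> : x1 * y1 - x2 * y2 = (x1 - x2) * y1 + x2 * (y1 - y2) by ring.
  by apply: rpredD; [exact: (@ZpowM _ pp 1 0)|exact: (@ZpowM _ pp 0 1)].
suff /and3P[] : R (\prod_(i < n) t i ^+ m i) (\prod_(i < n) u i ^+ m i) by [].
apply: (big_ind2 R) => // i _; elim: (m i) => // k IH; rewrite !exprS; apply: RM => //.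
by rewrite /R t0 u0 tu.
Qed.

Lemma Zpow_prod p (pp : prime p) n (x : 'I_n -> rat) (d m : 'I_n -> nat) :
    (forall i, x i \in Zpow pp (d i)) ->
  \prod_(i < n) x i ^+ m i \in Zpow pp (\sum_(i < n) m i * d i).
Proof.
move=> xd; apply: (big_ind2 (fun y k => y \in Zpow pp k)).
- exact: (Zpow_nat pp 1).
- by move=> ? ? ? ?; apply: ZpowM.
move=> i _; elim: (m i) => [|k IH]; first exact: (Zpow_nat pp 1).
by rewrite exprS mulSn; apply: ZpowM.
Qed.

(* If d < n is the least weight occurring in P, dividing the values of the e_(2i+2)
   by p^(2i+3) turns the weight d part of P into a form h in the Bernoulli
   numbers that vanishes modulo almost all p, contradicting BC. *)
Lemma least_weight (bc : BC) n d (P : {mpoly rat[n]}) : (0 < n)%N -> (d < n)%N ->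
    evdiv n (even_esym P) -> {in msupp P, forall m, d <= weight m}%N ->
  {in msupp P, forall m, d < weight m}%N.
Proof.
move=> n0 dn [N1 hP] wP m0 m0P; have := wP _ m0P; rewrite leq_eqVlt.
case/orP=> // /eqP wm0; exfalso.
(* The factor -1/(r+1) of [harmonic_gf_bernoulli] for r = 2i+2, moved into the coefficients of h so
   that h is evaluated at bare Bernoulli numbers. *)
pose c (i : nat) : rat := - (2 * i + 3)%:R^-1.
pose h : {mpoly rat[n]} := \sum_(m <- msupp P | weight m == d)
  (P@_m * \prod_(i < n) c i ^+ m i) *: 'X_[m].
have hE m : h@_m = if (m \in msupp P) && (weight m == d) then
    P@_m * \prod_(i < n) c i ^+ m i else 0.
  rewrite /h raddf_sum /= big_mkcond /=.
  have [mP|mP] := boolP (m \in msupp P); last first.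
    rewrite big_seq big1 // => k kP; case: ifP => // _.
    rewrite mcoeffZ mcoeffX; case: eqP => [kE|]; rewrite ?mulr0 //.
    by rewrite -kE kP in mP.
  rewrite (bigD1_seq m) ?msupp_uniq //= [X in _ + X]big1 ?addr0.
    by case: ifP => // _; rewrite mcoeffZ mcoeffX eqxx mulr1.
  by move=> k /negbTE km; case: ifP => // _; rewrite mcoeffZ mcoeffX km mulr0.
have h0 : h != 0.
  apply/eqP => /(congr1 (mcoeff m0)); rewrite hE m0P -wm0 eqxx mcoeff0 /=.
  apply/eqP; rewrite mulf_neq0 -?mcoeff_msupp //.
  by apply/prodf_neq0 => i _; rewrite expf_neq0 // oppr_eq0 invr_eq0 pnatr_eq0 addnS.
have hw : whomogeneous h.
  exists d => m; rewrite mcoeff_msupp hE; case: ifP; last by rewrite eqxx.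
  by case/andP => _ /eqP.
have [N2 hN2] := Zlocal_large [seq P@_m | m <- msupp P].
(* Beyond N1 the value of P is divisible by p^n, beyond N2 its coefficients are p-integral; p >=
   2n+3 makes p odd and gives 2i+3 < p for all i < n. *)
have [p [pp]] := bc n h n0 h0 hw (maxn (maxn N1 N2) (2 * n + 3)).
rewrite !geq_max -andbA => /and3P[pN1 pN2 pn] _ /negP; apply.
apply: (Zpow1_numq (p_pr := pp)).
have op : odd p by case: (even_prime pp) pn => // ->; lia.
have loc m : m \in msupp P -> P@_m \in Zpow pp 0.
  by move=> mP; rewrite Zpow0; apply: hN2 => //; apply/mapP; exists m.
pose x (i : nat) := (harmonic_gf p)`_(2 * i + 2).
pose t (i : nat) := x i / p%:R ^+ (2 * i + 3).
pose u (i : nat) := c i * bernoulli (p - (2 * i + 3)).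
have xZ (i : 'I_n) : x i \in Zpow pp (2 * i + 3).
  by rewrite addnS; apply: harmonic_gf_ZpowS; have := ltn_ord i; lia.
have tu (i : 'I_n) : t i - u i \in Zpow pp 1.
  rewrite /t /u mulNr opprK mulrC [X in _ + X]mulrC !addnS mulrC.
  have := @harmonic_gf_bernoulli p pp (2 * i + 2) .
  rewrite /x !addnS; apply => //; have := ltn_ord i; rewrite ?oddD ?oddM; lia.
have t0 (i : 'I_n) : t i \in Zpow pp 0 by rewrite Zpow0; have := xZ i; rewrite inE.
have u0 (i : 'I_n) : u i \in Zpow pp 0.
  by rewrite -[u i](subKr (t i)) rpredB // (Zpow_leq _ (tu i)).
have -> : h.@[fun i => bernoulli (p - (2 * i + 3))] =
    \sum_(m <- msupp P | weight m == d) P@_m * \prod_(i < n) u i ^+ m i.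
  rewrite /h raddf_sum /=; apply: eq_bigr => m _.
  rewrite mevalZ mevalX -mulrA -big_split /=; congr (_ * _).
  by apply: eq_bigr => i _; rewrite exprMn.
(* As d < n, the whole value is divisible by p^(d+1), and so is each term of weight above d; hence
   so is the part of weight d. *)
have hx : \sum_(m <- msupp P | weight m == d) P@_m * \prod_(i < n) x i ^+ m i
    \in Zpow pp d.+1.
  have : heval p (even_esym P) \in Zpow pp d.+1 by apply: Zpow_leq dn (hP _ _ pN1).
  rewrite even_esymE linear_sum /= (bigID (fun m => weight m == d)) /=.
  have vE m : heval p (P@_m *: \prod_(i < n) e_ (2 * i + 2) ^+ m i) =
      P@_m * \prod_(i < n) x i ^+ m i.
    rewrite linearZ /= rmorph_prod; congr (_ * _); apply: eq_bigr => i _.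
    by rewrite rmorphXn /= heval_esym.
  under eq_bigr => m _ do rewrite vE.
  rewrite rpredDr //.
  rewrite big_seq_cond; apply: rpred_sum => m /andP[mP wm]; rewrite vE.
  apply: (@ZpowM _ _ 0) (loc m mP) _.
  apply: Zpow_leq (Zpow_prod m xZ).
  by rewrite ltn_neqAle eq_sym wm wP.
have ht : \sum_(m <- msupp P | weight m == d) P@_m * \prod_(i < n) t i ^+ m i
    \in Zpow pp 1.
  have p0 : p%:R ^+ d != 0 :> rat by rewrite expf_neq0 // p_neq0.
  rewrite (_ : \sum_(_ <- _ | _) _ = (\sum_(m <- msupp P | weight m == d)
      P@_m * \prod_(i < n) x i ^+ m i) / p%:R ^+ d); last first.
    rewrite mulr_suml; apply: eq_bigr => m /eqP wm; rewrite -mulrA; congr (_ * _).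
    rewrite -wm /weight -prodrXr -prodfV -big_split /=; apply: eq_bigr => i _.
    by rewrite exprMn exprVn -exprM mulnC.
  by move: hx; rewrite !inE /= expr1 exprSr invfM mulrA mulrAC.
(* Replacing t by u changes the sum only by a multiple of p. *)
rewrite -(rpredBr _ ht) -sumrB big_seq_cond; apply: rpred_sum => m /andP[mP _].
rewrite -mulrBr; apply: (@ZpowM _ pp 0 1); first exact: loc.
rewrite -rpredN opprB; exact: Zpow1_prod.
Qed.

Theorem theorem5p1 (bc : BC) (f : symfun) (n : nat) (n_gt0 : (0 < n)%N) :
  (exists N : nat, forall p : nat, prime p -> (N <= p)%N ->
    eqmod_local p n (sfeval f (harmonic_point p)) 0) <->
  gen_ideal (range (beta n)) (symbar n f).
Proof.
split=> [/evdivP fn|]; last by move=> /(beta_ideal_evdiv n_gt0)/evdivP.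
have [P hP] := symfun_reducible n_gt0 f.
rewrite -/(beta_ideal n f) -[f](subrK (even_esym P)); apply: beta_idealD => //.
apply: even_esym_Hideal => //.
have {fn}Pn : evdiv n (even_esym P).
  rewrite -[even_esym P](subKr f) -scaleN1r; apply: evdivD => //.
  by apply: evdivZ; apply: beta_ideal_evdiv.
(* The lower bound for the weights rises one by one, [least_weight] excluding each d < n, until
   [even_esym_Hideal] applies. *)
suff H d : (d <= n)%N -> {in msupp P, forall m, d <= weight m}%N by exact: H.
by elim: d => // d IH dn; apply: least_weight => //; apply: IH; apply: ltnW.
Qed.
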